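(* Given the reduced DRL Gröbner basis $\mathcal{G}_{drl}$ of a generic ideal $\mathfrak{I}\subset\mathbb{K}[x_1,\ldots,x_n]$, the multiplication matrix $T_n$ (multiplication by $x_n$ in $\mathbb{K}[x_1,\ldots,x_n]/\mathfrak{I}$) can be read from $\mathcal{G}_{drl}$ with no arithmetic operation.
   Context: A generic ideal is one generated by $n$ dense polynomials of given degrees in $n$ variables with generic coefficients (outside a proper Zariski-closed subset of the coefficient space); it is zero-dimensional, of degree $D=\dim_{\mathbb{K}}\mathbb{K}[x_1,\ldots,x_n]/\mathfrak{I}$. DRL is the degree reverse lexicographical ordering with $x_1>\cdots>x_n$. $B=\{\epsilon_1,\ldots,\epsilon_D\}$ is the set of monomials not divisible by any DRL leading term of $\mathcal{G}_{drl}$; $T_n$ is the $D\times D$ matrix whose $i$-th column is the coordinate vector in $B$ of the DRL normal form of $\epsilon_i x_n$. An arithmetic operation is an addition or multiplication of two elements of $\mathbb{K}$ both different from $0$ and $\pm1$; a change of sign is not counted as an arithmetic operation. *)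

(* Defs.v *)
From HB Require Import structures.
From mathcomp Require Import all_boot all_algebra.
From mathcomp Require Import mpoly.
Set Implicit Arguments. Unset Strict Implicit. Unset Printing Implicit Defensive.
Import GRing.Theory.
Local Open Scope ring_scope.

Section Defs.
Variable K : fieldType.

(* Variables are x_1 > x_2 > ... > x_n, x_(i+1) being index i : 'I_n.
   DRL ordering: m1 <_drl m2 iff deg m1 < deg m2, or the degrees are equal
   and the last (rightmost) nonzero entry of m2 - m1 is negative. *)
Definition drl_lt {n} (m1 m2 : 'X_{1..n}) : bool :=
  (mdeg m1 < mdeg m2)%N ||
  ((mdeg m1 == mdeg m2) &&
   [exists i : 'I_n, (m2 i < m1 i)%N &&
      [forall j : 'I_n, (i < j)%N ==> (m1 j == m2 j)]]).

Definition is_lm {n} (p : {mpoly K[n]}) (m : 'X_{1..n}) : bool :=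
  (m \in msupp p) && all (fun m' => (m' == m) || drl_lt m' m) (msupp p).

Definition mdvd {n} (m1 m2 : 'X_{1..n}) : bool := lem m1 m2.

Definition in_ideal {n k} (f : 'I_k -> {mpoly K[n]}) (p : {mpoly K[n]}) : Prop :=
  exists q : 'I_k -> {mpoly K[n]}, p = \sum_(i < k) q i * f i.

Definition is_reduced_drl_gb {n} (I : {mpoly K[n]} -> Prop)
    (G : seq {mpoly K[n]}) : Prop :=
  [/\ uniq G,
      (forall g, g \in G -> I g),
      (forall g, g \in G -> exists m, is_lm g m /\ g@_m = 1),
      (forall p, I p -> p != 0 ->
         exists g mg mp, [/\ g \in G, is_lm g mg, is_lm p mp & mdvd mg mp])
    &
      (forall g g' m mg', g \in G -> g' \in G -> m \in msupp g ->
         is_lm g' mg' -> mdvd mg' m -> g = g' /\ m = mg')].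

Definition std_mon {n} (G : seq {mpoly K[n]}) (m : 'X_{1..n}) : Prop :=
  forall g mg, g \in G -> is_lm g mg -> ~~ mdvd mg m.

Definition is_nf {n} (I : {mpoly K[n]} -> Prop) (G : seq {mpoly K[n]})
    (p r : {mpoly K[n]}) : Prop :=
  I (p - r) /\ (forall m, m \in msupp r -> std_mon G m).

Definition CoeffIdx (n : nat) (d : 'I_n -> nat) : finType :=
  {i : 'I_n & 'X_{1..n < (d i).+1}}.

Definition dense_system {n} (d : 'I_n -> nat) (c : CoeffIdx d -> K)
    : 'I_n -> {mpoly K[n]} :=
  fun i => \sum_(m : 'X_{1..n < (d i).+1})
             c (Tagged (fun j => 'X_{1..n < (d j).+1}) m) *: 'X_[bmnm m].

Definition coeff_pt {n} (d : 'I_n -> nat) (c : CoeffIdx d -> K)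
    : 'I_#|CoeffIdx d| -> K :=
  fun j => c (enum_val j).

(* P holds for all coefficient vectors outside a proper Zariski-closed subset
   V(Ps) of the coefficient space K^N. *)
Definition generic_in {n} (d : 'I_n -> nat) (P : (CoeffIdx d -> K) -> Prop)
    : Prop :=
  exists Ps : seq {mpoly K[#|CoeffIdx d|]},
    (exists c0, has (fun Q => Q.@[coeff_pt c0] != 0) Ps) /\
    (forall c, has (fun Q => Q.@[coeff_pt c] != 0) Ps -> P c).

End Defs.

(* Main.v *)
Require Import Defs.
From HB Require Import structures.
From mathcomp Require Import all_boot all_algebra zify ring.
From mathcomp Require Import mpoly.
From Stdlib Require Import Classical.
Set Implicit Arguments. Unset Strict Implicit. Unset Printing Implicit Defensive.
Import GRing.Theory.
Local Open Scope ring_scope.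

(* Write z for the last variable and c for the sum of the d_j - 1. If, modulo the
   ideal and lower degree, multiplication by z^k from degree a to degree a + k is
   always injective or surjective, then a DRL leading monomial e z with e standard
   is a minimal generator of the initial ideal: see [lm_mul_last].

   The maximal rank property follows from the nonvanishing of finitely many
   determinants in the coefficients. Those of Macaulay's matrices make the
   monomials with all exponents m_j < d_j a basis of the quotient; the others
   express that z^(2D-c) is bijective from degree c - D to degree D.

   Over an infinite field, of any characteristic, the determinants are nonzero at
   f_j = prod_(t < d_j) (x_j - s^t x_(j-1)), with x_0 = 0 and the first powers of s
   distinct. Let l be the last of the first r variables. Adjoining x = x_(r+1), the
   quotient by the first r forms is spanned by strings of primitive elements under
   l, so the bijectivity of powers of x reduces to K[l, x]/(l^m, f_(r+1)(l, x)),
   where it is an interpolation problem at the points s^t with few monomials,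
   solved by a Vandermonde determinant. *)

(** * Supports, ideal combinations and spanning families *)

Section SupportedOn.
Variables (K : fieldType) (n : nat).
Implicit Types (P Q : pred 'X_{1..n}) (p q : {mpoly K[n]}).

Definition onmon P p : Prop := {in msupp p, forall m, P m}.

Lemma onmon0 P : onmon P 0.
Proof. by move=> m; rewrite msupp0. Qed.

Lemma onmonD P p q : onmon P p -> onmon P q -> onmon P (p + q).
Proof. by move=> hp hq m /msuppD_le; rewrite mem_cat => /orP[/hp|/hq]. Qed.

Lemma onmonZ P a p : onmon P p -> onmon P (a *: p).
Proof. by move=> hp m /msuppZ_le /hp. Qed.

Lemma onmonN P p : onmon P p -> onmon P (- p).
Proof. by rewrite -scaleN1r; apply: onmonZ. Qed.

Lemma onmonB P p q : onmon P p -> onmon P q -> onmon P (p - q).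
Proof. by move=> hp hq; apply: onmonD => //; apply: onmonN. Qed.

Lemma onmon_sum P (I : Type) (r : seq I) (C : pred I) (F : I -> {mpoly K[n]}) :
  (forall i, C i -> onmon P (F i)) -> onmon P (\sum_(i <- r | C i) F i).
Proof.
by move=> h; elim/big_ind: _ => //; [apply: onmon0 | apply: onmonD].
Qed.

Lemma onmonX P m : P m -> onmon P 'X_[m].
Proof. by move=> h m'; rewrite msuppX inE => /eqP->. Qed.

Lemma onmonM P Q (S : pred 'X_{1..n}) p q :
  onmon P p -> onmon Q q ->
  (forall m m', P m -> Q m' -> S (m + m')%MM) -> onmon S (p * q).
Proof.
by move=> hp hq h m /msuppM_le /allpairsP[[m1 m2] /= [/hp h1 /hq h2 ->]]; apply: h.
Qed.

Lemma onmonW P Q p : (forall m, P m -> Q m) -> onmon P p -> onmon Q p.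
Proof. by move=> h hp m /hp /h. Qed.

Lemma onmon_ind P (C : {mpoly K[n]} -> Prop) :
  C 0 -> (forall p q, C p -> C q -> C (p + q)) ->
  (forall a p, C p -> C (a *: p)) -> (forall m, P m -> C 'X_[m]) ->
  forall p, onmon P p -> C p.
Proof.
move=> h0 hD hZ hX p hp; rewrite [p]mpolyE big_seq.
by elim/big_ind: _ => // m /hp /hX; apply: hZ.
Qed.

Definition restr P p : {mpoly K[n]} := \sum_(m <- msupp p | P m) p@_m *: 'X_[m].

Lemma mcoeff_restr P p m : (restr P p)@_m = if P m then p@_m else 0.
Proof.
rewrite {2}[p]mpolyE /restr big_mkcond !raddf_sum /=.
case: ifP => Pm; [apply: eq_bigr => v _|apply: big1 => v _]; case: ifP => Pv;
  rewrite ?mcoeff0 // !mcoeffZ !mcoeffX; case: eqP => [e|_]; rewrite ?mulr0 //.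
  by rewrite e Pm in Pv.
by rewrite e Pm in Pv.
Qed.

Lemma onmon_restr Q P p : onmon Q p -> onmon (fun m => Q m && P m) (restr P p).
Proof.
move=> hp; rewrite /restr big_seq_cond; apply: onmon_sum => m /andP[/hp h1 h2].
by apply/onmonZ/onmonX; rewrite h1 h2.
Qed.

Lemma onmon_restrN Q P p : onmon Q p -> onmon (fun m => Q m && ~~ P m) (p - restr P p).
Proof.
move=> hp; rewrite {1}[p]mpolyE (bigID P) /= /restr addrAC subrr add0r.
rewrite big_seq_cond; apply: onmon_sum => m /andP[/hp h1 h2].
by apply/onmonZ/onmonX; rewrite h1 h2.
Qed.

End SupportedOn.

Section Comb.
Variables (K : fieldType) (n : nat) (f : 'I_n -> {mpoly K[n]}).
Implicit Types (Q : 'I_n -> pred 'X_{1..n}) (p g : {mpoly K[n]}).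

(** Each generator has its own set of allowed multiplier monomials, so that degree bounds and
    Macaulay's restricted multipliers are instances of one notion. *)
Definition comb Q p : Prop :=
  exists q : 'I_n -> {mpoly K[n]},
    p = \sum_(j < n) q j * f j /\ forall j, onmon (Q j) (q j).

Lemma comb0 Q : comb Q 0.
Proof.
exists (fun _ => 0); split=> [|j]; last exact: onmon0.
by rewrite big1 // => j _; rewrite mul0r.
Qed.

Lemma combD Q p g : comb Q p -> comb Q g -> comb Q (p + g).
Proof.
move=> [q [-> hq]] [q' [-> hq']]; exists (fun j => q j + q' j); split.
  by rewrite -big_split; apply: eq_bigr => j _; rewrite mulrDl.
by move=> j; apply: onmonD.
Qed.

Lemma combZ Q a p : comb Q p -> comb Q (a *: p).
Proof.
move=> [q [-> hq]]; exists (fun j => a *: q j); split.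
  by rewrite scaler_sumr; apply: eq_bigr => j _; rewrite scalerAl.
by move=> j; apply: onmonZ.
Qed.

Lemma combN Q p : comb Q p -> comb Q (- p).
Proof. by rewrite -scaleN1r; apply: combZ. Qed.

Lemma combB Q p g : comb Q p -> comb Q g -> comb Q (p - g).
Proof. by move=> hp hg; apply: combD => //; apply: combN. Qed.

Lemma comb_gen Q j g : onmon (Q j) g -> comb Q (g * f j).
Proof.
move=> h; exists (fun i => if i == j then g else 0); split.
  by rewrite (bigD1 j) //= eqxx big1 ?addr0 // => i /negPf ->; rewrite mul0r.
by move=> i; case: eqP => [->|_] //; apply: onmon0.
Qed.

Lemma combM Q Q' (S : pred 'X_{1..n}) p g :
  (forall j m m', S m -> Q j m' -> Q' j (m + m')%MM) ->
  onmon S g -> comb Q p -> comb Q' (g * p).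
Proof.
move=> h hg [q [-> hq]]; exists (fun j => g * q j); split.
  by rewrite mulr_sumr; apply: eq_bigr => j _; rewrite mulrA.
by move=> j; apply: onmonM hg (hq j) (h j).
Qed.

Lemma combW Q Q' p : (forall j m, Q j m -> Q' j m) -> comb Q p -> comb Q' p.
Proof. by move=> h [q [-> hq]]; exists q; split=> // j; apply: onmonW (hq j); apply: h. Qed.

Lemma comb_ind Q (C : {mpoly K[n]} -> Prop) :
  C 0 -> (forall p q, C p -> C q -> C (p + q)) ->
  (forall a p, C p -> C (a *: p)) ->
  (forall j m, Q j m -> C ('X_[m] * f j)) ->
  forall p, comb Q p -> C p.
Proof.
move=> h0 hD hZ hX p [q [-> hq]]; elim/big_ind: _ => // j _.
move: (q j) (hq j); apply: onmon_ind => [|a b ha hb|a b ha|m /hX //].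
- by rewrite mul0r.
- by rewrite mulrDl; apply: hD.
- by rewrite -scalerAl; apply: hZ.
Qed.

Lemma comb_ideal Q p : comb Q p -> in_ideal f p.
Proof. by move=> [q [-> _]]; exists q. Qed.

Lemma ideal0 : in_ideal f 0.
Proof. exact: comb_ideal (comb0 (fun _ => xpredT)). Qed.

Lemma ideal_comb p : in_ideal f p <-> comb (fun _ => xpredT) p.
Proof. by split=> [[q ->]|[q [-> _]]]; exists q. Qed.

Lemma idealD p g : in_ideal f p -> in_ideal f g -> in_ideal f (p + g).
Proof. by move=> /ideal_comb hp /ideal_comb hg; apply/ideal_comb/combD. Qed.

Lemma idealB p g : in_ideal f p -> in_ideal f g -> in_ideal f (p - g).
Proof. by move=> /ideal_comb hp /ideal_comb hg; apply/ideal_comb/combB. Qed.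

Lemma idealM p g : in_ideal f p -> in_ideal f (g * p).
Proof. by move=> /ideal_comb hp; apply/ideal_comb; apply: (@combM _ _ xpredT) hp. Qed.

End Comb.

Section Triangular.
Variables (K : fieldType) (n D : nat).
Local Notation T := 'X_{1..n < D.+1}.
Implicit Types (P : T -> {mpoly K[n]}) (p : {mpoly K[n]}).

(** The index set, the monomials of degree at most [D], is also a basis of the space to be spanned,
    so for families of degree at most [D] spanning is the invertibility of a square matrix. *)
Definition lspan P p : Prop := exists a : T -> K, p = \sum_m a m *: P m.

Lemma lspan0 P : lspan P 0.
Proof. by exists (fun _ => 0); rewrite big1 // => m _; rewrite scale0r. Qed.

Lemma lspanD P p q : lspan P p -> lspan P q -> lspan P (p + q).
Proof.
move=> [a ->] [b ->]; exists (fun m => a m + b m); rewrite -big_split.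
by apply: eq_bigr => m _; rewrite scalerDl.
Qed.

Lemma lspanZ P c p : lspan P p -> lspan P (c *: p).
Proof.
move=> [a ->]; exists (fun m => c * a m); rewrite scaler_sumr.
by apply: eq_bigr => m _; rewrite scalerA.
Qed.

Lemma lspan_gen P m : lspan P (P m).
Proof.
exists (fun m' => (m' == m)%:R); rewrite (bigD1 m) //= eqxx scale1r big1 ?addr0 //.
by move=> i /negPf->; rewrite scale0r.
Qed.

Definition degle (d : nat) : pred 'X_{1..n} := fun m => (mdeg m <= d)%N.

Definition rowmx P : 'M[K]_#|{: T}| := \matrix_(i, j) (P (enum_val i))@_(enum_val j : T).

Lemma lspan_degle p : onmon (degle D) p -> p = \sum_(m : T) p@_m *: 'X_[m].
Proof.
move=> hp; apply: mpolywE; rewrite msizeE; apply/bigmax_leqP_seq => m hm _.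
exact: hp.
Qed.

Lemma sum_rowmx P (a : 'rV[K]_#|{: T}|) :
  (forall m, onmon (degle D) (P m)) ->
  \sum_i a 0 i *: P (enum_val i) =
  \sum_j (a *m rowmx P) 0 j *: 'X_[(enum_val j : T)].
Proof.
move=> hP; under [RHS]eq_bigr => j _ do rewrite mxE scaler_suml.
rewrite exchange_big /=; apply: eq_bigr => i _.
rewrite [in LHS](lspan_degle (hP _)) scaler_sumr.
rewrite (reindex (@enum_val _ {: T})) /=; last by apply/onW_bij/enum_val_bij.
by apply: eq_bigr => j _; rewrite scalerA !mxE.
Qed.

Lemma rowmx_spans P : (forall m, onmon (degle D) (P m)) -> \det (rowmx P) != 0 ->
  forall p, onmon (degle D) p -> lspan P p.
Proof.
move=> hP hdet p hp; have hU : rowmx P \in unitmx by rewrite unitmxE unitfE.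
pose b : 'rV[K]_#|{: T}| := \row_j p@_(enum_val j : T).
exists (fun m => (b *m invmx (rowmx P)) 0 (enum_rank m)).
rewrite (reindex (@enum_val _ {: T})) /=; last by apply/onW_bij/enum_val_bij.
under eq_bigr => j _ do rewrite enum_valK.
rewrite sum_rowmx // mulmxKV // [LHS](lspan_degle hp).
rewrite (reindex (@enum_val _ {: T})) /=; last by apply/onW_bij/enum_val_bij.
by apply: eq_bigr => j _; rewrite mxE.
Qed.

Lemma spans_rowmx P : (forall m : T, lspan P 'X_[m]) ->
  exists B, B *m rowmx P = 1%:M.
Proof.
move=> h; have /fin_all_exists[a ha] := h.
exists (\matrix_(i, j) a (enum_val i) (enum_val j)).
apply/matrixP => i j; rewrite !mxE.
have := congr1 (mcoeff (enum_val j : T)) (ha (enum_val i)).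
rewrite mcoeffX raddf_sum /= (reindex (@enum_val _ {: T})) /=; last first.
  by apply/onW_bij/enum_val_bij.
rewrite -bmeqP (inj_eq enum_val_inj) => ->.
by apply: eq_bigr => k _; rewrite mcoeffZ !mxE.
Qed.

Lemma spans_det P : (forall m : T, lspan P 'X_[m]) -> \det (rowmx P) != 0.
Proof.
move=> /spans_rowmx[B hB]; have := congr1 determinant hB.
by rewrite det_mulmx det1 => h; apply: contra_eq_neq h => ->; rewrite mulr0 eq_sym oner_eq0.
Qed.

(* A square spanning family is independent. *)
Lemma spans_dual P : (forall m : T, lspan P 'X_[m]) ->
  exists L : T -> {mpoly K[n]} -> K,
    [/\ forall m p q, L m (p + q) = L m p + L m q,
        forall m a p, L m (a *: p) = a * L m p &
        forall m m', L m (P m') = (m == m')%:R].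
Proof.
(* A one-sided inverse of a square matrix is two-sided; the columns of [B] are the coordinate
   functionals. *)
move=> /spans_rowmx[B /mulmx1C hB].
exists (fun m p => \sum_j p@_(enum_val j : T) * B j (enum_rank m)); split.
- by move=> m p q; rewrite -big_split; apply: eq_bigr => j _; rewrite mcoeffD mulrDl.
- by move=> m a p; rewrite mulr_sumr; apply: eq_bigr => j _; rewrite mcoeffZ mulrA.
move=> m m'; have := congr1 (fun M : 'M_#|{: T}| => M (enum_rank m') (enum_rank m)) hB.
rewrite !mxE (inj_eq enum_rank_inj) eq_sym => <-.
by apply: eq_bigr => j _; rewrite mxE enum_rankK.
Qed.

End Triangular.

(** * Macaulay matrices *)

Section Macaulay.
Variables (K : fieldType) (n : nat) (d : 'I_n -> nat) (f : 'I_n -> {mpoly K[n]}).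
Implicit Types (m : 'X_{1..n}) (p b : {mpoly K[n]}).

(** At [i = n] these are the box monomials, the expected basis of the quotient; smaller [i] serves
    inductions on the number of forms. *)
Definition below (i : nat) m : bool := [forall j : 'I_n, (j < i)%N ==> (m j < d j)%N].

Lemma belowP i m : reflect (forall j : 'I_n, (j < i)%N -> (m j < d j)%N) (below i m).
Proof. by apply: (iffP forallP) => h j; [move/implyP: (h j) | apply/implyP/h]. Qed.

(** The clause [below j m] makes [j] the least index with [d j <= m j]: each monomial outside the
    box is assigned to one form, as in Macaulay's construction. *)
Definition pivot (i : nat) m : option 'I_n :=
  [pick j : 'I_n | [&& (j < i)%N, (d j <= m j)%N & below j m]].

Lemma pivot_below i m : below i m -> pivot i m = None.
Proof.
move=> /belowP h; rewrite /pivot; case: pickP => // j /and3P[/h hj].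
by rewrite leqNgt hj.
Qed.

Lemma pivot_eq (i : nat) (j : 'I_n) m :
  (j < i)%N -> (d j <= m j)%N -> below j m -> pivot i m = Some j.
Proof.
move=> hi hd hb; rewrite /pivot; case: pickP => [k /and3P[_ hk kb]|/(_ j)]; last first.
  by rewrite hi hd hb.
case: (ltngtP k j) => [kj|jk|/val_inj-> //].
  by move/belowP: hb => /(_ _ kj); rewrite ltnNge hk.
by move/belowP: kb => /(_ _ jk); rewrite ltnNge hd.
Qed.

Variant pivot_spec (i : nat) m : option 'I_n -> Prop :=
| PivotSome (j : 'I_n) of (j < i)%N & (d j <= m j)%N & below j m : pivot_spec i m (Some j)
| PivotNone of below i m : pivot_spec i m None.

Lemma pivotP i m : pivot_spec i m (pivot i m).
Proof.
rewrite /pivot; case: pickP => [j /and3P[]|h]; first exact: PivotSome.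
apply/PivotNone/belowP => j; have [N] := ubnP (val j); elim: N j => // N IH j jN ji.
rewrite ltnNge; apply/negP => hd; move: (h j); rewrite ji hd /= => /negP; apply.
by apply/belowP => k kj; apply: IH; [exact: leq_trans kj jN|exact: ltn_trans kj ji].
Qed.

(* The rows of Macaulay's resultant matrix. *)
Definition theta (i : nat) m : {mpoly K[n]} :=
  if pivot i m is Some j then 'X_[m - U_(j) *+ d j] * f j else 'X_[m].

(** Multipliers for combinations of the first [i] forms whose products stay in degree at most [D]
    when [f j] has degree at most [d j]. [VQ] keeps a single product for each monomial outside the
    box. *)
Definition IQ (i D : nat) (j : 'I_n) : pred 'X_{1..n} :=
  fun m => (j < i)%N && (mdeg m + d j <= D)%N.

Definition VQ (i D : nat) (j : 'I_n) : pred 'X_{1..n} :=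
  fun m => IQ i D j m && below j m.

Definition BQ (i D : nat) : pred 'X_{1..n} := fun m => below i m && (mdeg m <= D)%N.

Lemma VQ_IQ i D p : comb f (VQ i D) p -> comb f (IQ i D) p.
Proof. by apply: combW => j m /andP[]. Qed.

Lemma IQ_leq i D D' p : (D <= D')%N -> comb f (IQ i D) p -> comb f (IQ i D') p.
Proof. by move=> h; apply: combW => j m /andP[h1 h2]; rewrite /IQ h1; lia. Qed.

Lemma IQ_mul i D E p g : onmon (degle E) g ->
  comb f (IQ i D) p -> comb f (IQ i (E + D)) (g * p).
Proof.
apply: combM => j m m' hm /andP[h1 h2].
by rewrite /IQ h1 /= mdegD; move: hm; rewrite /degle; lia.
Qed.

Lemma mnm_splitU (j : 'I_n) e m : (e <= m j)%N -> (m - U_(j) *+ e + U_(j) *+ e)%MM = m.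
Proof.
move=> h; apply: submK; apply/mnm_lepP => k; rewrite mulmnE mnm1E.
by case: eqP => [<-|]; rewrite ?mul1n ?mul0n.
Qed.

Lemma mdeg_splitU (j : 'I_n) e m : (e <= m j)%N ->
  (mdeg (m - U_(j) *+ e)%MM + e)%N = mdeg m.
Proof. by move=> /mnm_splitU {2}<-; rewrite mdegD mdegMn mdeg1 mul1n. Qed.

Lemma below_splitU (i : nat) (j : 'I_n) e m : (i <= j)%N ->
  below i (m + U_(j) *+ e)%MM = below i m.
Proof.
move=> hij; apply: eq_forallb => k; case: ltnP => // ki /=.
rewrite mnmDE mulmnE mnm1E; case: eqP => [e'|_]; last by rewrite mul0n addn0.
by move: ki; rewrite -e'; lia.
Qed.

Lemma theta_gen (i : nat) (j : 'I_n) m : (j < i)%N -> below j m ->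
  theta i (m + U_(j) *+ d j)%MM = 'X_[m] * f j.
Proof.
move=> ji hb; rewrite /theta (@pivot_eq i j) ?addmK ?below_splitU //.
by rewrite mnmDE mulmnE mnm1E eqxx; lia.
Qed.

Lemma theta_box i m : below i m -> theta i m = 'X_[m].
Proof. by move=> /pivot_below h; rewrite /theta h. Qed.

Hypothesis f_deg : forall j, onmon (degle (d j)) (f j).

Lemma theta_cases i D m : (mdeg m <= D)%N ->
  comb f (VQ i D) (theta i m) \/ (below i m /\ theta i m = 'X_[m]).
Proof.
move=> hm; rewrite /theta; case: pivotP => [j ji hd hb|hb]; [left|by right].
apply/comb_gen/onmonX; rewrite /VQ /IQ ji /= (mdeg_splitU hd) hm /=.
by apply/belowP => k kj; move/belowP: hb => /(_ k kj); rewrite mnmBE; lia.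
Qed.

Lemma onmon_comb i D p : comb f (IQ i D) p -> onmon (degle D) p.
Proof.
apply: comb_ind => [|a b|a b|j m /andP[_ h]];
  [exact: onmon0|exact: onmonD|exact: onmonZ|].
apply: onmonM (@onmonX K _ (pred1 m) m (eqxx m)) (@f_deg j) _ => m1 m2 /eqP->.
by rewrite /degle mdegD; lia.
Qed.

Lemma theta_deg i D m : (mdeg m <= D)%N -> onmon (degle D) (theta i m).
Proof.
move=> hm; case: (theta_cases i hm) => [/VQ_IQ/onmon_comb //|[_ ->]].
exact: onmonX.
Qed.

(** The forms need not be homogeneous, so the degree bound on the products is information that
    membership of [p - b] in the ideal does not carry. *)
Definition reducible (i D : nat) p : Prop :=
  exists b, comb f (IQ i D) (p - b) /\ onmon (BQ i D) b.

Lemma reducible0 i D : reducible i D 0.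
Proof. by exists 0; rewrite subr0; split; [apply: comb0|apply: onmon0]. Qed.

Lemma reducibleD i D p q : reducible i D p -> reducible i D q -> reducible i D (p + q).
Proof.
move=> [b [h1 h2]] [b' [h1' h2']]; exists (b + b').
by rewrite opprD addrACA; split; [apply: combD|apply: onmonD].
Qed.

Lemma reducibleZ i D a p : reducible i D p -> reducible i D (a *: p).
Proof.
move=> [b [h1 h2]]; exists (a *: b).
by rewrite -scalerBr; split; [apply: combZ|apply: onmonZ].
Qed.

Lemma reducible_comb i D p : comb f (IQ i D) p -> reducible i D p.
Proof. by move=> h; exists 0; rewrite subr0; split=> //; apply: onmon0. Qed.

Lemma reducible_box i D b : onmon (BQ i D) b -> reducible i D b.
Proof. by move=> h; exists b; rewrite subrr; split=> //; apply: comb0. Qed.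

Lemma reducible_leq i D D' p : (D <= D')%N -> reducible i D p -> reducible i D' p.
Proof.
move=> h [b [h1 h2]]; exists b; split; first exact: IQ_leq h1.
by apply: onmonW h2 => m /andP[hb hm]; rewrite /BQ hb; lia.
Qed.

Definition all_reducible (i D : nat) : Prop := forall p, onmon (degle D) p -> reducible i D p.

Lemma theta_all_reducible i D :
  (forall p, onmon (degle D) p -> lspan (fun m : 'X_{1..n < D.+1} => theta i m) p) ->
  all_reducible i D.
Proof.
move=> h p /h[a ->]; elim/big_ind: _ => [||m _];
  [exact: reducible0|exact: reducibleD|apply: reducibleZ].
have hm : (mdeg m <= D)%N by have := bmdeg m.
case: (theta_cases i hm) => [/VQ_IQ/reducible_comb //|[hb ->]].
by apply/reducible_box/onmonX; rewrite /BQ hb.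
Qed.

(** For positive [d j], the largest degree of a box monomial: the socle degree of a complete
    intersection of forms of degrees [d j]. *)
Definition socdeg : nat := \sum_j (d j).-1.

Section Bounded.
Hypothesis d_gt0 : forall j, (0 < d j)%N.

(** This makes finitely many determinants enough. Write a monomial as [x_j * m'], reduce [m'] to box
    monomials [v] by induction, and split [x_j * v] into [lo], in the first [i] variables, and [hi],
    in the others. The degree of [lo] is within the bound, and multiplying its reduction by [hi]
    leaves the first [i] exponents unchanged. *)
Lemma all_reducible_from_bound i :
  (forall D, (D <= socdeg.+1)%N -> all_reducible i D) -> forall D, all_reducible i D.
Proof.
move=> hS; elim=> [|D IH]; first exact: hS.
case: (leqP D.+1 socdeg.+1) => [/hS //|_].
apply: onmon_ind => [|p q|a p|m hm];
  [exact: reducible0|exact: reducibleD|exact: reducibleZ|].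
case: (leqP (mdeg m) D) => hD.
  by apply: (@reducible_leq i D) => //; apply/IH/onmonX.
have /existsP[j hj] : [exists j : 'I_n, (0 < m j)%N].
  apply: contraT => /existsPn h; suff : mdeg m = 0%N by lia.
  by rewrite mdegE big1 // => j _; have := h j; lia.
have em := mnm_splitU hj; have dm := mdeg_splitU hj; rewrite -em.
have [|b [h1 h2]] := IH 'X_[m - U_(j) *+ 1].
  by apply/onmonX; move: hm dm; rewrite /degle; lia.
rewrite mpolyXD -[X in X * _](subrK b) mulrDl; apply: reducibleD.
  rewrite mulrC; apply/reducible_comb/(@IQ_mul i D 1) => //.
  by apply/onmonX; rewrite /degle mdegMn mdeg1.
move: b h2 {h1}; apply: onmon_ind => [|p q|a p|v /andP[vb vD]].
- by rewrite mul0r; apply: reducible0.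
- by rewrite mulrDl; apply: reducibleD.
- by rewrite -scalerAl; apply: reducibleZ.
rewrite -mpolyXD; set w := (v + _)%MM.
have wD : (mdeg w <= D.+1)%N by rewrite mdegD mdegMn mdeg1; lia.
pose lo := [multinom (if (k < i)%N then w k else 0%N) | k < n].
pose hi := [multinom (if (k < i)%N then 0%N else w k) | k < n].
have ew : w = (hi + lo)%MM.
  by apply/mnmP => k; rewrite mnmDE !mnmE; case: ifP; rewrite ?addn0.
(* The exponents of [v] before index [i] are at most [(d k).-1], and multiplication by [x_j] raises
   a single exponent, by one. *)
have dlo : (mdeg lo <= socdeg.+1)%N.
  have -> : socdeg = ((d j).-1 + \sum_(k | k != j) (d k).-1)%N.
    by rewrite /socdeg (bigD1 j).
  rewrite mdegE (bigD1 j) //= -addSn leq_add //.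
    rewrite mnmE; case: ifP => // ji; rewrite mnmDE mulmnE mnm1E eqxx.
    by move/belowP: vb => /(_ j ji); lia.
  apply: leq_sum => k kj; rewrite mnmE; case: ifP => // ki.
  rewrite mnmDE mulmnE mnm1E eq_sym (negPf kj).
  by move/belowP: vb => /(_ k ki); lia.
have [|b [h1 h2]] := hS _ dlo 'X_[lo]; first exact/onmonX/leqnn.
have dw : (mdeg hi + mdeg lo)%N = mdeg w by rewrite -mdegD ew.
have hhi : onmon (degle (mdeg hi)) ('X_[hi] : {mpoly K[n]}) by apply/onmonX/leqnn.
apply: (@reducible_leq i (mdeg hi + mdeg lo)); first by rewrite dw.
rewrite ew mpolyXD -['X_[lo]](subrK b) mulrDr; apply: reducibleD.
  exact/reducible_comb/IQ_mul.
apply: reducible_box; apply: onmonM (@onmonX K _ (pred1 hi) hi (eqxx hi)) h2 _ =>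
  _ m' /eqP-> /andP[mb md].
rewrite /BQ mdegD; apply/andP; split; last by lia.
by apply/belowP => k ki; rewrite mnmDE mnmE ki; move/belowP: mb; apply.
Qed.

End Bounded.

Section Consequences.
Hypothesis f_red : forall i D, (i <= n)%N -> all_reducible i D.

(** The multiplier of the last form is reduced modulo the earlier ones. Its box part is allowed by
    [VQ]; the rest, times the last form, is a combination of the earlier forms, to which the
    induction applies. *)
Lemma IQ_VQ i D p : (i <= n)%N -> comb f (IQ i D) p -> comb f (VQ i D) p.
Proof.
elim: i D p => [|i IH] D p hi; apply: comb_ind => [|a b|a b|j m /andP[ji hm]];
  try exact: comb0; try exact: combD; try exact: combZ; first by [].
have hW g : comb f (IQ i D) g -> comb f (VQ i.+1 D) g.
  move=> /(IH _ _ (ltnW hi)); apply: combW => k m' /andP[/andP[h1 h2] h3].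
  by rewrite /VQ /IQ h2 h3 ltnS ltnW.
move: ji; rewrite ltnS leq_eqVlt => /orP[/eqP ej|ji]; last first.
  by apply/hW/comb_gen/onmonX; rewrite /IQ ji.
have hm' : onmon (degle (D - d j)) ('X_[m] : {mpoly K[n]}).
  by apply/onmonX; rewrite /degle; lia.
have [b [h1 h2]] := f_red (ltnW hi) hm'.
rewrite -['X_[m]](subrK b) mulrDl; apply: combD.
  apply: hW; rewrite mulrC; have := IQ_mul (@f_deg j) h1.
  by rewrite subnKC //; lia.
apply: comb_gen; apply: onmonW h2 => v /andP[vb vD].
by rewrite /VQ /IQ ej leqnn vb; lia.
Qed.

(** The products allowed by [VQ] and the box monomials are exactly the rows of Macaulay's matrix. *)
Lemma all_reducible_theta D p : onmon (degle D) p ->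
  lspan (fun m : 'X_{1..n < D.+1} => theta n m) p.
Proof.
have hgen m : (mdeg m <= D)%N -> lspan (fun m : 'X_{1..n < D.+1} => theta n m) (theta n m).
  move=> hm; exact: (lspan_gen _ (BMultinom (hm : (mdeg m < D.+1)%N))).
move=> /(f_red (leqnn n))[b [/(IQ_VQ (leqnn n)) h1 h2]].
rewrite -[p](subrK b); apply: lspanD.
  move: h1; apply: comb_ind => [|q q'|a q|j m /andP[/andP[ji hm] hb]];
    [exact: lspan0|exact: lspanD|exact: lspanZ|].
  by rewrite -(@theta_gen n) //; apply: hgen; rewrite mdegD mdegMn mdeg1 mul1n.
move: h2; apply: onmon_ind => [|q q'|a q|m /andP[hb hm]];
  [exact: lspan0|exact: lspanD|exact: lspanZ|].
by rewrite -(@theta_box n) //; apply: hgen.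
Qed.

Lemma ideal_IQ p : in_ideal f p -> exists2 E, comb f (IQ n E) p & onmon (degle E) p.
Proof.
move=> [q ->]; exists (\max_j (msize (q j) + d j))%N; last apply: (@onmon_comb n).
  all: exists q; split=> // j m hm; rewrite /IQ ltn_ord /=.
  all: apply: leq_trans (leq_bigmax j); rewrite leq_add2r.
  all: exact/ltnW/msize_mdeg_lt.
Qed.

(** In a degree [E] large enough for the cofactors, the rows [theta] form a square spanning family.
    The coordinate functional of a box monomial [m] kills the products allowed by [VQ], which are
    rows of monomials outside the box, and reads off the coefficient of [m] on box polynomials. *)
Lemma box_indep b : onmon (below n) b -> in_ideal f b -> b = 0.
Proof.
move=> hb /ideal_IQ[E /(IQ_VQ (leqnn n)) h1 h2].
have [m|L [LD LZ LP]] := @spans_dual K n E (fun m : bmultinom n E.+1 => theta n m).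
  by apply/all_reducible_theta/onmonX; have := bmdeg m.
apply/mpolyP => m; rewrite mcoeff0; apply/eqP; rewrite mcoeff_eq0; apply/negP => hm.
have mE : (mdeg m < E.+1)%N by exact: h2.
pose M := BMultinom (mE : (mdeg _ < _)%N); have mb := hb _ hm.
have L0 : L M 0 = 0 by have := LZ M 0 0; rewrite scale0r mul0r.
have : L M b = 0.
  move: h1; apply: (comb_ind (C := fun p => L M p = 0)) => [|p q h h'|a p h|j v /andP[/andP[ji hv] vb]] //.
  - by rewrite LD h h' addr0.
  - by rewrite LZ h mulr0.
  have wE : (mdeg (v + U_(j) *+ d j)%MM < E.+1)%N.
    by rewrite mdegD mdegMn mdeg1 mul1n.
  have := LP M (BMultinom (wE : (mdeg _ < _)%N)); rewrite theta_gen // => ->.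
  case: eqP => // /(congr1 (@bmnm _ _)) /= e.
  move/belowP: mb => /(_ j (ltn_ord j)).
  by rewrite e mnmDE mulmnE mnm1E eqxx; lia.
suff -> : L M b = b@_m by move/eqP; rewrite mcoeff_eq0 hm.
suff : forall p, onmon (BQ n E) p -> L M p = p@_m.
  by apply; move=> v hv; rewrite /BQ hb //; apply: h2.
apply: (onmon_ind (C := fun p => L M p = p@_m)) => [|p q h h'|a p h|v /andP[vb vE]].
- by rewrite L0 mcoeff0.
- by rewrite LD mcoeffD h h'.
- by rewrite LZ mcoeffZ h.
have := LP M (BMultinom (vE : (mdeg v < E.+1)%N)); rewrite theta_box // => ->.
by rewrite mcoeffX eq_sym.
Qed.

(** No cancellation above degree [D] is needed to express [p]: its reduction leaves a box polynomial
    in the ideal, which is zero by [box_indep]. *)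
Lemma ideal_VQ D p : in_ideal f p -> onmon (degle D) p -> comb f (VQ n D) p.
Proof.
move=> hI /(f_red (leqnn n))[b [/(IQ_VQ (leqnn n)) h1 h2]].
have b0 : b = 0.
  apply: box_indep; first by apply: onmonW h2 => m /andP[].
  by rewrite -[b](subKr p); apply: idealB => //; apply: comb_ideal h1.
by rewrite b0 subr0 in h1.
Qed.

End Consequences.

End Macaulay.

(** * The maximal rank property *)

Section Lefschetz.
Variables (K : fieldType) (n : nat) (d : 'I_n.+1 -> nat) (f : 'I_n.+1 -> {mpoly K[n.+1]}).
Hypothesis d_gt0 : forall j, (0 < d j)%N.
Implicit Types (m : 'X_{1..n.+1}) (p b h r : {mpoly K[n.+1]}).
Local Notation c := (socdeg d).
Local Notation N := (n.+1).

Definition zpow (k : nat) : {mpoly K[n.+1]} := 'X_[U_(ord_max) *+ k].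

Lemma zpowD k l : zpow (k + l) = zpow k * zpow l.
Proof.
rewrite /zpow -mpolyXD; congr 'X_[_]; apply/mnmP => j.
by rewrite mnmDE !mulmnE mulnDr.
Qed.

Lemma zpowE k : zpow k = 'X_ord_max ^+ k.
Proof. by rewrite mpolyXn. Qed.

Lemma onmon_zpow k (P Q : pred 'X_{1..n.+1}) h :
  (forall m, P m -> Q (U_(ord_max) *+ k + m)%MM) -> onmon P h -> onmon Q (zpow k * h).
Proof.
move=> hPQ hh; apply: (onmonM (@onmonX K _ (pred1 _) _ (eqxx _)) hh).
by move=> _ m /eqP-> /hPQ.
Qed.

Lemma mdeg_zpow k m : mdeg (U_(ord_max) *+ k + m)%MM = (k + mdeg m)%N.
Proof. by rewrite mdegD mdegMn mdeg1 mul1n. Qed.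

Definition deglt (e : nat) : pred 'X_{1..n.+1} := fun m => (mdeg m < e)%N.
Definition degeq (e : nat) : pred 'X_{1..n.+1} := fun m => mdeg m == e.

(** On the box, an involution exchanging the degrees [a] and [c - a]. *)
Definition compl m : 'X_{1..n.+1} := [multinom ((d j).-1 - m j)%N | j < n.+1].

Lemma complK m : below d N m -> compl (compl m) = m.
Proof.
move=> /belowP h; apply/mnmP => j; rewrite !mnmE.
by have := h j (ltn_ord j); lia.
Qed.

Lemma below_compl m : below d N (compl m).
Proof. by apply/belowP => j _; rewrite mnmE; have := d_gt0 j; lia. Qed.

Lemma mdeg_compl m : below d N m -> (mdeg (compl m) + mdeg m)%N = c.
Proof.
move=> /belowP h; rewrite -mdegD mdegE; apply: eq_bigr => j _.
by rewrite mnmDE mnmE; have := h j (ltn_ord j); lia.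
Qed.

Lemma mdeg_below m : below d N m -> (mdeg m <= c)%N.
Proof. by move=> /mdeg_compl <-; apply: leq_addl. Qed.

(* The rows of the matrix of multiplication by [z^(2D-c)] between the
   box monomials of the complementary degrees [c-D] and [D]. *)
Definition psi (D : nat) m : {mpoly K[n.+1]} :=
  if below d N m && (mdeg m == D) then zpow (2 * D - c) * 'X_[compl m]
  else theta d f N m.

Hypothesis f_deg : forall j, onmon (degle (d j)) (f j).

Lemma psi_deg D m : (c <= 2 * D)%N -> (mdeg m <= D)%N -> onmon (degle D) (psi D m).
Proof.
move=> hD hm; rewrite /psi; case: ifP => [/andP[/mdeg_compl hc /eqP hmD]|_]; last first.
  exact: theta_deg.
rewrite -mpolyXD; apply/onmonX; rewrite /degle mdeg_zpow; lia.
Qed.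

Hypothesis f_red : forall i D, (i <= N)%N -> all_reducible d f i D.
Hypothesis f_psi : forall D p, (D <= c)%N -> (c <= 2 * D)%N -> onmon (degle D) p ->
  lspan (fun m : 'X_{1..n.+1 < D.+1} => psi D m) p.

(** In an expansion of [p] in the rows [psi], those of box monomials of degree [D] are multiples of
    [z^(2D-c)], box monomials of smaller degree go into [r], and the other rows lie in the ideal. *)
Lemma lefschetz_surj D p : (D <= c)%N -> (c <= 2 * D)%N -> onmon (degle D) p ->
  exists h r, [/\ onmon (degle (c - D)) h, onmon (deglt D) r &
                  in_ideal f (p - (zpow (2 * D - c) * h + r))].
Proof.
move=> h1 h2 /(f_psi h1 h2)[a ->].
elim/big_ind: _ => [|p1 p2|m _].
- exists 0, 0; rewrite mulr0 addr0 subrr.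
  by split; [exact: onmon0|exact: onmon0|exact: ideal0].
- move=> [u [r [hu hr I1]]] [u' [r' [hu' hr' I2]]]; exists (u + u'), (r + r').
  split; [exact: onmonD|exact: onmonD|].
  have := idealD I1 I2; congr in_ideal; ring.
have hm : (mdeg m <= D)%N by have := bmdeg m.
rewrite /psi; case: ifP => [/andP[hb /eqP hD]|hn].
  exists (a m *: 'X_[compl m]), 0; split; [|exact: onmon0|].
    by apply/onmonZ/onmonX; have := mdeg_compl hb; rewrite /degle; lia.
  by rewrite addr0 -scalerAr subrr; apply: ideal0.
case: (theta_cases d f N hm) => [/comb_ideal hI|[hb eX]].
  exists 0, 0; split; [exact: onmon0|exact: onmon0|].
  by rewrite mulr0 addr0 subr0 -mul_mpolyC; apply: idealM.
exists 0, (a m *: 'X_[m]); rewrite mulr0 add0r eX subrr; split; [exact: onmon0| |exact: ideal0].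
by apply/onmonZ/onmonX; move: hn; rewrite hb /= /deglt; lia.
Qed.

(** The rows [psi] have coordinate functionals. That of the complement of [m] kills the ideal
    elements of degree at most [D], whose [VQ] products are other rows, and the box monomials of
    degree below [D]; it sends [z^(2D-c) * b] to the coefficient of [m] in [b]. *)
Lemma lefschetz_inj D b r : (D <= c)%N -> (c <= 2 * D)%N ->
  onmon (fun m => below d N m && (mdeg m == c - D)%N) b -> onmon (deglt D) r ->
  in_ideal f (zpow (2 * D - c) * b + r) -> b = 0.
Proof.
move=> h1 h2 hb hr hI.
have [b' [hI' hb']] : exists b', in_ideal f (r - b') /\
    onmon (fun m => below d N m && (mdeg m < D)%N) b'.
  (* For [D = 0] the remainder is zero; otherwise it is reduced in degree [D - 1], which keeps its
     degree below [D]. *)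
  case: D h1 h2 hb hr hI => [|D] h1 h2 hb hr hI.
    exists 0; rewrite subr0; split; last exact: onmon0.
    rewrite (_ : r = 0); first exact: ideal0.
    by apply/mpolyP => m; rewrite mcoeff0; apply/eqP; rewrite mcoeff_eq0; apply/negP => /hr.
  have [b' [/comb_ideal H1 H2]] := f_red (leqnn N) (hr : onmon (degle D) r).
  by exists b'.
have hI2 : in_ideal f (zpow (2 * D - c) * b + b').
  have := idealB hI hI'; congr in_ideal; ring.
have hdeg : onmon (degle D) (zpow (2 * D - c) * b + b').
  apply: onmonD; last by apply: onmonW hb' => m /andP[_ /ltnW].
  apply: onmon_zpow hb => m /andP[_ /eqP e]; rewrite /degle mdeg_zpow; lia.
have := ideal_VQ f_deg f_red hI2 hdeg => hV {hI hI' hI2 hdeg hr}.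
have [m|L [LD LZ LP]] := @spans_dual K N D (fun m : bmultinom N D.+1 => psi D m).
  by apply: f_psi => //; apply/onmonX; have := bmdeg m.
apply/mpolyP => m; rewrite mcoeff0; apply/eqP; rewrite mcoeff_eq0; apply/negP => hm.
have /andP[mb /eqP me] := hb _ hm.
have hD : mdeg (compl m) = D by have := mdeg_compl mb; lia.
have hD' : (mdeg (compl m) < D.+1)%N by rewrite hD.
pose M := BMultinom hD'.
have L0 : L M 0 = 0 by have := LZ M 0 0; rewrite scale0r mul0r.
have Lpsi v : (mdeg v <= D)%N -> L M (psi D v) = (compl m == v)%:R.
  by move=> hv; have := LP M (BMultinom (hv : (mdeg v < D.+1)%N)).
have LV : L M (zpow (2 * D - c) * b + b') = 0.
  move: hV; apply: (comb_ind (C := fun p => L M p = 0)) =>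
    [|p q h h'|a p h|j v /andP[/andP[ji hv] vb]] //.
  - by rewrite LD h h' addr0.
  - by rewrite LZ h mulr0.
  have hj : ~~ below d N (v + U_(j) *+ d j)%MM.
    apply/negP => /belowP /(_ j (ltn_ord j)).
    by rewrite mnmDE mulmnE mnm1E eqxx; lia.
  have := Lpsi (v + U_(j) *+ d j)%MM; rewrite /psi (negPf hj) /= theta_gen // => ->.
    by case: eqP => // e; move: hj; rewrite -e below_compl.
  by rewrite mdegD mdegMn mdeg1 mul1n.
have Lb' : L M b' = 0.
  move: hb'; apply: (onmon_ind (C := fun p => L M p = 0)) => [|p q h h'|a p h|v /andP[vb vD]] //.
  - by rewrite LD h h' addr0.
  - by rewrite LZ h mulr0.
  have := Lpsi v (ltnW vD); rewrite /psi vb /= ltn_eqF // theta_box // => ->.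
  by case: eqP => // e; move: vD; rewrite -e hD ltnn.
suff : L M (zpow (2 * D - c) * b) = b@_m.
  by move: LV; rewrite LD Lb' addr0 => -> /esym/eqP; rewrite mcoeff_eq0 hm.
move: b hb {hm hV LV}; apply: (onmon_ind (C := fun b => L M (zpow (2 * D - c) * b) = b@_m)) =>
  [|p q h h'|a p h|v /andP[vb /eqP ve]].
- by rewrite mulr0 L0 mcoeff0.
- by rewrite mulrDr LD mcoeffD h h'.
- by rewrite -scalerAr LZ mcoeffZ h.
have hv : mdeg (compl v) = D by have := mdeg_compl vb; lia.
have := Lpsi (compl v); rewrite /psi below_compl hv eqxx complK //= => -> //.
rewrite mcoeffX; congr (_ %:R); congr nat_of_bool; apply/eqP/eqP => [e|-> //].
by rewrite -[m]complK // e complK.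
Qed.

(** If [2a + k <= c], then [z^k] is the first factor of the bijection [z^(c-2a)] from degree [a] to
    [c - a], hence injective. Otherwise, with [D = a + k <= c], it is the last factor of the
    bijection [z^(2D-c)] from degree [c - D < a] to [D], hence surjective. *)
Lemma max_rank a k :
  (forall h r, onmon (degeq a) h -> onmon (deglt (a + k)) r ->
     in_ideal f (zpow k * h + r) ->
     exists2 r', onmon (deglt a) r' & in_ideal f (h + r')) \/
  (forall p, onmon (degle (a + k)) p ->
     exists h r, [/\ onmon (degle a) h, onmon (deglt (a + k)) r &
                     in_ideal f (p - (zpow k * h + r))]).
Proof.
case: (leqP (2 * a + k) c) => hc; [left|right].
  move=> h r hh hr hI.
  have hh' : onmon (degle a) h by apply: onmonW hh => m /eqP; rewrite /degle => ->.
  have [b [/comb_ideal I1 hb]] := f_red (leqnn N) hh'.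
  have hb1 := @onmon_restr _ _ _ (degeq a) _ hb; have hb2 := @onmon_restrN _ _ _ (degeq a) _ hb.
  move: (restr _ b) hb1 hb2 => b1 hb1 hb2.
  have b10 : b1 = 0.
    (* The relation is multiplied by [z^(c-2a-k)], which brings the exponent of [z] to [c - 2a];
       [b1] is the degree-[a] part of the reduction of [h]. *)
    apply: (@lefschetz_inj (c - a) b1
      (zpow (2 * (c - a) - c) * (b - b1) + zpow (c - 2 * a - k) * r)); try lia.
    - apply: onmonW hb1 => m /andP[/andP[-> _] /eqP ->] /=; apply/eqP; lia.
    - apply: onmonD.
        apply: onmon_zpow hb2 => m /andP[/andP[_ h1] h2].
        rewrite /deglt mdeg_zpow; move: h2; rewrite /degeq; lia.
      by apply: onmon_zpow hr => m; rewrite /deglt mdeg_zpow; lia.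
    have := idealB (idealM (zpow (c - 2 * a - k)) hI)
                   (idealM (zpow (2 * (c - a) - c)) I1).
    have -> : (2 * (c - a) - c = (c - 2 * a - k) + k)%N by lia.
    rewrite zpowD; congr in_ideal; ring.
  exists (- b); last exact: I1.
  apply: onmonN; move: hb2; rewrite b10 subr0; apply: onmonW => m /andP[/andP[_ h1] h2].
  by move: h2; rewrite /degeq /deglt; lia.
move=> p hp; case: (leqP (a + k) c) => hD.
  have h2D : (c <= 2 * (a + k))%N by lia.
  have [h [r [hh hr hI]]] := lefschetz_surj hD h2D hp.
  exists (zpow (2 * a + k - c) * h), r; split=> //.
    by apply: onmon_zpow hh => m; rewrite /degle mdeg_zpow; lia.
  rewrite mulrA -zpowD; have -> : (k + (2 * a + k - c) = 2 * (a + k) - c)%N by lia.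
  by [].
(* There are no box monomials above degree [c], so the reduction of [p] has lower degree and [h = 0]
   suffices. *)
have [b [/comb_ideal I1 hb]] := f_red (leqnn N) hp.
exists 0, b; split; [exact: onmon0| |by rewrite mulr0 add0r].
by apply: onmonW hb => m /andP[/mdeg_below hm _]; rewrite /deglt; lia.
Qed.

End Lefschetz.

(** * DRL leading monomials *)

Section DRL.
Variables (n : nat).
Implicit Types m : 'X_{1..n.+1}.

Lemma drl_lt_asym m1 m2 : drl_lt m1 m2 -> ~~ drl_lt m2 m1.
Proof.
rewrite /drl_lt => h; apply/negP => h'; move: h h'.
case: (ltngtP (mdeg m1) (mdeg m2)) => //= _.
move=> /existsP[i /andP[hi /forallP h]] /existsP[j /andP[hj /forallP h']].
case: (ltngtP i j) => [ij|ji|/val_inj ij].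
- by have /implyP/(_ ij)/eqP e := h j; lia.
- by have /implyP/(_ ji)/eqP e := h' i; lia.
- by subst j; lia.
Qed.

Lemma drl_lt_add m m1 m2 : drl_lt (m1 + m)%MM (m2 + m)%MM = drl_lt m1 m2.
Proof.
rewrite /drl_lt !mdegD ltn_add2r eqn_add2r; congr (_ || (_ && _)).
apply: eq_existsb => i; rewrite !mnmDE ltn_add2r; congr (_ && _).
by apply: eq_forallb => j; rewrite !mnmDE eqn_add2r.
Qed.

Lemma drl_lt_mdeg m1 m2 : drl_lt m1 m2 -> (mdeg m1 <= mdeg m2)%N.
Proof. by rewrite /drl_lt => /orP[/ltnW //|/andP[/eqP-> _]]. Qed.

(** Thus a power of the last variable dividing a leading monomial divides all the other monomials of
    the same degree. *)
Lemma drl_lt_last m1 m2 : drl_lt m1 m2 -> mdeg m1 = mdeg m2 ->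
  (m2 ord_max <= m1 ord_max)%N.
Proof.
rewrite /drl_lt => h e; move: h; rewrite e ltnn eqxx /=.
move=> /existsP[i /andP[hi /forallP h]].
have [->|ne] := eqVneq ord_max i; first exact: ltnW.
have /implyP := h ord_max; rewrite ltn_neqAle -ltnS ltn_ord andbT.
by move=> /(_ _)/eqP-> //; apply: contra_neq ne => e'; apply/val_inj.
Qed.

Lemma last_drl_lt m1 m2 : mdeg m1 = mdeg m2 -> (m2 ord_max < m1 ord_max)%N ->
  drl_lt m1 m2.
Proof.
move=> e h; rewrite /drl_lt e ltnn eqxx /=; apply/existsP; exists ord_max.
rewrite h; apply/forallP => j; apply/implyP => hj.
by have := ltn_ord j; move: hj => /=; lia.
Qed.

Variable K : fieldType.
Implicit Types p : {mpoly K[n.+1]}.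

Lemma is_lmP p m : reflect
  (m \in msupp p /\ forall m', m' \in msupp p -> m' != m -> drl_lt m' m) (is_lm p m).
Proof.
apply: (iffP andP) => [[h /allP h']|[h h']]; split=> //.
  by move=> m' /h' /orP[->|].
by apply/allP => m' /h'; case: eqVneq => //= _ ->.
Qed.

Lemma is_lm_uniq p m m' : is_lm p m -> is_lm p m' -> m = m'.
Proof.
move=> /is_lmP[h1 h2] /is_lmP[h3 h4]; apply/eqP/negPn/negP => ne.
have := drl_lt_asym (h4 _ h1 ne); rewrite h2 // eq_sym; exact: ne.
Qed.

Lemma is_lmMX p m m' : is_lm p m -> is_lm (p * 'X_[m']) (m + m')%MM.
Proof.
move=> /is_lmP[h1 h2]; apply/is_lmP; split.
  by rewrite mcoeff_msupp addmC mcoeffMX -mcoeff_msupp.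
move=> v /msuppM_le /allpairsP[[v1 v2] /= [hv1]].
rewrite msuppX inE => /eqP-> -> /=; rewrite (can_eq (addmK m')) drl_lt_add.
exact: h2.
Qed.

Lemma zpow_dvd k (P : pred 'X_{1..n.+1}) p :
  onmon (fun m => P m && (k <= m ord_max)%N) p ->
  exists2 h, p = zpow K n k * h & onmon (fun m => P (U_(ord_max) *+ k + m)%MM) h.
Proof.
move: p; apply: onmon_ind => [|p q [h -> hh] [h' -> hh']|a p [h -> hh]|m /andP[Pm km]].
- by exists 0; rewrite ?mulr0 //; apply: onmon0.
- by exists (h + h'); rewrite ?mulrDr //; apply: onmonD.
- by exists (a *: h); rewrite ?scalerAr //; apply: onmonZ.
exists 'X_[m - U_(ord_max) *+ k].
  by rewrite -mpolyXD addmC mnm_splitU.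
by apply: onmonX; rewrite addmC mnm_splitU.
Qed.

End DRL.

(** * Standard monomials multiplied by the last variable *)

Section GroebnerBasis.
Variables (K : fieldType) (n : nat) (f : 'I_n.+1 -> {mpoly K[n.+1]}).
Implicit Types (m : 'X_{1..n.+1}) (p h r : {mpoly K[n.+1]}).
Variable G : seq {mpoly K[n.+1]}.
Hypothesis G_gb : is_reduced_drl_gb (in_ideal f) G.

Lemma ideal_lm_nstd p m : in_ideal f p -> is_lm p m -> ~ std_mon G m.
Proof.
move=> hI hm hs; have [_ _ _ hG _] := G_gb.
have p0 : p != 0.
  by apply: contraTneq hm => ->; rewrite /is_lm msupp0.
have [g [mg [mp [gG lg lp dv]]]] := hG _ hI p0.
by move: dv; rewrite (is_lm_uniq lp hm); apply/negP; apply: hs lg.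
Qed.

Lemma std_mon_dvd m m' : (m <= m')%MM -> std_mon G m' -> std_mon G m.
Proof.
move=> mm hs g mg gG lg; apply/negP => h; have := hs g mg gG lg.
by rewrite /mdvd (lepm_trans h mm).
Qed.

Hypothesis f_max_rank : forall a k,
  (forall h r, onmon (@degeq n a) h -> onmon (@deglt n (a + k)) r ->
     in_ideal f (zpow K n k * h + r) ->
     exists2 r', onmon (@deglt n a) r' & in_ideal f (h + r')) \/
  (forall p, onmon (degle (a + k)) p ->
     exists h r, [/\ onmon (degle a) h, onmon (@deglt n (a + k)) r &
                     in_ideal f (p - (zpow K n k * h + r))]).

Local Notation xl := (@ord_max n).

(* If [e * z] were a proper multiple [x_j * u] of a leading monomial [u], write
   [u = z^k * u'] with [k] maximal; injectivity of multiplication by [z^k] makes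
   [u'], a divisor of [e], a leading monomial; surjectivity does the same for [e],
   which is DRL-larger than all multiples of [z^k] of its degree. *)
Lemma lm_mul_last e g t : std_mon G e -> g \in G -> is_lm g t ->
  mdvd t (e + U_(xl))%MM -> t = (e + U_(xl))%MM.
Proof.
move=> he gG lt /mnm_lepP dt; have [_ hGI _ _ _] := G_gb.
apply/eqP; case: eqVneq => // ne; exfalso.
have /negP nte : ~~ mdvd t e by exact: he lt.
(* As [t] divides [e z] but not [e], it has the full exponent of [z]. Being different from [e z], it
   then has a smaller exponent at some other [x_j], and so divides [u = e z / x_j]. *)
have tl : t xl = (e xl).+1.
  have := dt xl; rewrite mnmDE mnm1E eqxx addn1.
  case: ltngtP => // tl _; case: nte; apply/mnm_lepP => i.
  have := dt i; rewrite mnmDE mnm1E; case: eqP => [<- _|_]; last by rewrite addn0.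
  by rewrite -ltnS.
have [j jl hj] : exists2 j, j != xl & (t j < e j)%N.
  apply: NNPP => hn; case/eqP: ne; apply/mnmP => i.
  have [->|il] := eqVneq i xl; first by rewrite mnmDE mnm1E eqxx addn1.
  have := dt i; rewrite mnmDE mnm1E eq_sym (negPf il) addn0 => ti.
  apply/eqP; rewrite eqn_leq ti leqNgt; apply/negP => hi.
  by case: hn; exists i.
pose k := (e xl).+1; pose u := (e + U_(xl) - U_(j))%MM.
pose u' := (u - U_(xl) *+ k)%MM.
have ul : u xl = k.
  by rewrite mnmBE mnmDE !mnm1E eqxx (negPf jl) addn1 subn0.
have uu' : (u' + U_(xl) *+ k)%MM = u by apply: mnm_splitU; rewrite ul.
have tu : (t <= u)%MM.
  apply/mnm_lepP => i; rewrite mnmBE mnmDE !mnm1E; have := dt i.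
  rewrite mnmDE mnm1E; case: (eqVneq j i) => [<-|]; last by rewrite subn0.
  by rewrite eq_sym (negPf jl); lia.
have u'e : (u' <= e)%MM.
  apply/mnm_lepP => i; rewrite !mnmBE mnmDE mulmnE !mnm1E.
  by case: (eqVneq xl i) => [<-|_]; rewrite /k; lia.
have du : mdeg u = mdeg e.
  have : (mdeg (u + U_(j) *+ 1)%MM = mdeg (e + U_(xl)))%N.
    congr mdeg; apply: mnm_splitU; rewrite mnmDE; lia.
  by rewrite !mdegD mdegMn !mdeg1; lia.
have du' : (mdeg u' + k = mdeg e)%N by rewrite -du -uu' mdegD mdegMn mdeg1 mul1n.
pose p := g * 'X_[u - t].
have lp : is_lm p u by rewrite -(submK tu) addmC; exact: is_lmMX.
have Ip : in_ideal f p by rewrite /p mulrC; apply/idealM/hGI.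
have [pu pmax] := is_lmP _ _ lp.
case: (f_max_rank (mdeg u') k) => [inj|surj]; last first.
  have [h [r [hh hr hI]]] := surj 'X_[e] (@onmonX _ _ (degle _) _ (eq_leq (esym du'))).
  have zh : onmon (fun m => (k <= m xl)%N && (mdeg m <= mdeg e)%N) (zpow K n k * h).
    apply: onmon_zpow hh => m hm; rewrite mnmDE mulmnE mnm1E eqxx mul1n leq_addr.
    by rewrite mdeg_zpow -du' addnC leq_add2r.
  (* The exponent of [z] in [e] is [k - 1], so [e] does not occur in [z^k * h], and every monomial
     of its degree that does is DRL-smaller. *)
  apply: ideal_lm_nstd hI _ he; apply/is_lmP; split.
    rewrite mcoeff_msupp mcoeffB mcoeffX eqxx mcoeffD.
    rewrite [(zpow _ _ _ * _)@__]memN_msupp_eq0; last first.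
      by apply/negP => /zh /andP[]; rewrite /k ltnn.
    rewrite [r@__]memN_msupp_eq0 ?addr0 ?subr0 ?oner_eq0 //.
    by apply/negP => /hr; rewrite /deglt du' ltnn.
  move=> m /msuppB_le; rewrite mem_cat msuppX inE => /orP[->//|/msuppD_le].
  rewrite mem_cat => /orP[/zh/andP[h1 h2] _|/hr h1 _]; last first.
    by move: h1; rewrite /deglt du' /drl_lt => ->.
  move: h2; rewrite leq_eqVlt => /orP[/eqP h2|h2]; last by rewrite /drl_lt h2.
  exact: last_drl_lt.
(* The part of [p] in the degree of its leading monomial [u]; it is divisible by [z^k] because [u]
   is. *)
pose p1 := restr (degeq (mdeg e)) p.
have hp1 : onmon (fun m => degeq (mdeg e) m && (k <= m xl)%N) p1.
  move=> m; rewrite mcoeff_msupp mcoeff_restr; case: ifP; rewrite ?eqxx //= => hm.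
  rewrite -mcoeff_msupp => mp; have [->|mu] := eqVneq m u; first by rewrite ul.
  by rewrite -ul; apply: drl_lt_last (pmax _ mp mu) _; rewrite du; apply/eqP.
have [h e1 hh] := zpow_dvd hp1.
have hh' : onmon (degeq (mdeg u')) h.
  by apply: onmonW hh => m; rewrite /degeq mdeg_zpow -du' addnC eqn_add2r.
have hr : onmon (@deglt n (mdeg u' + k)) (p - p1).
  move=> m; rewrite mcoeff_msupp mcoeffB mcoeff_restr /deglt du'.
  case: ifP; rewrite ?subrr ?eqxx // subr0 -mcoeff_msupp => /negbT hm mp.
  have [mu|mu] := eqVneq m u; first by rewrite mu /degeq du eqxx in hm.
  by rewrite ltn_neqAle -{2}du (drl_lt_mdeg (pmax _ mp mu)) andbT; apply: hm.
have [|r' hr' hI] := inj h (p - p1) hh' hr; first by rewrite -e1 addrC subrK.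
have hcoef m : h@_m = p1@_(m + U_(xl) *+ k)%MM by rewrite e1 mulrC addmC mcoeffMX.
apply: ideal_lm_nstd hI _ (std_mon_dvd u'e he); apply/is_lmP; split.
  rewrite mcoeff_msupp mcoeffD hcoef uu' mcoeff_restr /degeq du eqxx.
  rewrite [r'@__]memN_msupp_eq0 ?addr0 -?mcoeff_msupp //.
  by apply/negP => /hr'; rewrite /deglt ltnn.
move=> m /msuppD_le; rewrite mem_cat => /orP[|/hr' hm _]; last first.
  by rewrite /drl_lt; move: hm; rewrite /deglt => ->.
rewrite mcoeff_msupp hcoef mcoeff_restr; case: ifP; rewrite ?eqxx // => _.
rewrite -mcoeff_msupp => mp mu; rewrite -(drl_lt_add (U_(xl) *+ k)) uu'.
by apply: pmax mp _; rewrite -uu' (can_eq (addmK _)).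
Qed.

(** If [e z] is not standard, a leading monomial divides it, hence equals it by [lm_mul_last]. The
    corresponding [g] is monic and the basis is reduced, so the other monomials of [g] are standard
    and [e z - g] is the normal form. *)
Lemma column_nf e : std_mon G e ->
  let ex := (e + U_(xl))%MM in
  exists r, is_nf (in_ideal f) G 'X_[ex] r /\
    ((std_mon G ex /\ r = 'X_[ex]) \/
     (exists g, [/\ g \in G, is_lm g ex & r = 'X_[ex] - g])).
Proof.
move=> he ex; have [_ hGI hGm _ hGr] := G_gb.
have [[g [t [gG lt dt]]]|hn] :=
    classic (exists g t, [/\ g \in G, is_lm g t & mdvd t ex]).
  have et := lm_mul_last he gG lt dt; rewrite et in lt.
  exists ('X_[ex] - g); split; last by right; exists g.
  split; first by rewrite subKr; apply: hGI.
  move=> m hm; have mg : m \in msupp g /\ m != ex.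
    have [t' [lt' g1]] := hGm _ gG; rewrite (is_lm_uniq lt' lt) in g1.
    have me : m != ex.
      by apply: contraTneq hm => ->; rewrite mcoeff_msupp mcoeffB mcoeffX eqxx g1 subrr eqxx.
    by move: hm => /msuppB_le; rewrite mem_cat msuppX inE (negPf me).
  case: mg => mg me g' mg' gG' lg'; apply/negP => dv.
  have [eg em] := hGr _ _ _ _ gG gG' mg lg' dv.
  by case/eqP: me; rewrite em; apply: is_lm_uniq lt; rewrite eg.
have hs : std_mon G ex.
  by move=> g t gG lt; apply/negP => dt; case: hn; exists g, t.
exists 'X_[ex]; split; last by left.
split; first by rewrite subrr; apply: ideal0.
by move=> m; rewrite msuppX inE => /eqP->.
Qed.

End GroebnerBasis.

(** * Interpolation by binary forms *)

Section BinaryForms.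
Variables (K : fieldType) (R : comAlgType K) (l z : R).
Implicit Types (p v : {poly K}).

(** The homogenization [l^D * p(z / l)]. Coefficients of [p] above degree [D] are dropped, whence
    the size hypotheses in the product rules. *)
Definition bform (D : nat) p : R := \sum_(a < D.+1) p`_a *: (l ^+ (D - a) * z ^+ a).

Lemma bformB D p v : bform D (p - v) = bform D p - bform D v.
Proof.
by rewrite /bform -sumrB; apply: eq_bigr => a _; rewrite coefB scalerBl.
Qed.

Lemma bformZ D a p : bform D (a *: p) = a *: bform D p.
Proof.
by rewrite /bform scaler_sumr; apply: eq_bigr => i _; rewrite coefZ scalerA.
Qed.

Lemma bform_sum D (I : finType) (F : I -> {poly K}) :
  bform D (\sum_i F i) = \sum_i bform D (F i).
Proof.
rewrite /bform exchange_big; apply: eq_bigr => a _.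
by rewrite coef_sum scaler_suml.
Qed.

Lemma bformXn D b : (b <= D)%N -> bform D 'X^b = l ^+ (D - b) * z ^+ b.
Proof.
move=> hb; rewrite /bform (bigD1 (Ordinal (hb : (b < D.+1)%N))) //= coefXn eqxx scale1r.
rewrite big1 ?addr0 // => i ib; rewrite coefXn; case: eqP => [e|_]; last by rewrite scale0r.
by case/eqP: ib; apply: val_inj.
Qed.

Lemma bformM D p x : (size p <= D.+1)%N ->
  bform D.+1 (p * ('X - x%:P)) = bform D p * (z - x *: l).
Proof.
move=> hp; rewrite mulrBr bformB mulrBr [p * x%:P]mulrC mul_polyC bformZ; congr (_ - _).
  rewrite /bform big_ord_recl coefMX /= scale0r add0r mulr_suml.
  apply: eq_bigr => a _; rewrite coefMX /= -scalerAl exprSr mulrA.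
  by rewrite /bump /= add1n subSS.
rewrite -scalerAr; congr (_ *: _).
rewrite /bform big_ord_recr /= (nth_default _ hp) scale0r addr0 mulr_suml.
apply: eq_bigr => a _; rewrite -scalerAl subSn; last by rewrite -ltnS.
by rewrite exprSr mulrAC.
Qed.

Lemma bform_prod E v (s : K) k : (size v <= E.+1)%N ->
  bform (E + k) (v * \prod_(j < k) ('X - (s ^+ j)%:P)) =
  bform E v * \prod_(j < k) (z - s ^+ j *: l).
Proof.
move=> hv; elim: k => [|k IH]; first by rewrite !big_ord0 !mulr1 addn0.
rewrite !big_ord_recr /= !mulrA -IH addnS bformM //.
apply: leq_trans (size_polyMleq _ _) _; rewrite size_prod_XsubC.
by rewrite -[index_enum _]enumT size_enum_ord; lia.
Qed.

Variables (s : K) (B : nat).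
Hypothesis s_inj : forall a b, (a <= B)%N -> (b <= B)%N -> s ^+ a = s ^+ b -> a = b.

(* A polynomial with [k] terms can interpolate any values at the [k] points
   [s ^ j]: the Vandermonde matrix at the points [s ^ (e t)]. *)
Lemma sparse_interpolation k (e : 'I_k -> nat) b :
  injective e -> (forall t, e t <= B)%N ->
  exists w : 'I_k -> K, forall i : 'I_k,
    (s ^+ i) ^+ b = \sum_t w t * (s ^+ i) ^+ e t.
Proof.
move=> e_inj eB; pose V := Vandermonde k (\row_t s ^+ e t : 'rV[K]_k).
have hV : V \in unitmx.
  rewrite unitmxE unitfE det_Vandermonde; apply/prodf_neq0 => i _.
  apply/prodf_neq0 => j ij; rewrite !mxE subr_eq0; apply/negP => /eqP.
  move=> /(s_inj (eB _) (eB _)) /e_inj ji; by rewrite ji ltnn in ij.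
pose w := invmx V *m \col_(i < k) (s ^+ i) ^+ b.
exists (fun t => w t 0) => i.
have := congr1 (fun M : 'cV[K]_k => M i 0) (mulKVmx hV (\col_(i < k) (s ^+ i) ^+ b)).
rewrite -/w !mxE => <-; apply: eq_bigr => t _; rewrite !mxE mulrC.
by rewrite -!exprM mulnC.
Qed.

(** Put [U = D + 1 - m]. Among the monomials [l^(D-a) z^a], the multiples of [l^m] have [a < U] and
    those of [z^k] have [a >= k]. If [k <= U] this covers all of them. Otherwise at least [dd] are
    available; [dd] of them interpolate [X^b] at the points [s^j], and the difference is a multiple
    of the product of the [X - s^j]. *)
Lemma binary_form D m dd k b :
  (2 * D + 2 = m + dd + k)%N -> (0 < m)%N -> (0 < dd)%N -> (D <= B)%N -> (b <= D)%N ->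
  exists (w : 'I_dd -> K) (e : 'I_dd -> nat) (v : {poly K}),
    [/\ l ^+ (D - b) * z ^+ b =
          \sum_t w t *: (l ^+ (D - e t) * z ^+ e t) +
          bform (D - dd) v * \prod_(j < dd) (z - s ^+ j *: l),
        forall t, (e t <= D)%N /\ ((m <= D - e t)%N \/ (k <= e t)%N) &
        v != 0 -> (dd <= D)%N].
Proof.
move=> hD hm hdd DB bD; pose U := (D.+1 - m)%N.
case: (leqP k U) => kU.
  exists (fun t => (val t == 0%N)%:R), (fun _ => b), 0; split; last by rewrite eqxx.
    rewrite /bform [X in _ = _ + X * _]big1 ?mul0r ?addr0; last first.
      by move=> i _; rewrite coef0 scale0r.
    rewrite -scaler_suml (bigD1 (Ordinal hdd)) //= big1 ?addr0 ?scale1r //.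
    by move=> i /negPf; rewrite -val_eqE /= => ->.
  by move=> _; split=> //; move: kU; rewrite /U; lia.
(* The exponents [0, ..., U - 1], then [k, k + 1, ...], jumping over the gap; the equation on [D]
   keeps them at most [D]. *)
pose e (t : 'I_dd) := if (t < U)%N then val t else (k + (t - U))%N.
have eD t : (e t <= D)%N /\ ((m <= D - e t)%N \/ (k <= e t)%N).
  have tk := ltn_ord t; rewrite /e /U in kU *; case: (ltnP t (D.+1 - m)) => /=; lia.
have e_inj : injective e.
  move=> t t' h; apply: val_inj; move: h; rewrite /e.
  rewrite /U in kU *; case: (ltnP t (D.+1 - m)); case: (ltnP t' (D.+1 - m)) => /=; lia.
have eB t : (e t <= B)%N by have [h _] := eD t; apply: leq_trans h DB.
have [w hw] := sparse_interpolation b e_inj eB.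
pose g : {poly K} := 'X^b - \sum_t w t *: 'X^(e t).
have hdD : (dd <= D.+1)%N.
  rewrite -(card_ord dd) -(card_ord D.+1).
  have h t : (e t < D.+1)%N by have [] := eD t.
  apply: (@leq_card _ _ (fun t => Ordinal (h t))) => t t' /(congr1 val) /=; exact: e_inj.
have sg : (size g <= D.+1)%N.
  apply: leq_trans (size_polyD _ _) _; rewrite geq_max size_polyXn ltnS bD size_polyN.
  apply: leq_trans (size_sum _ _ _) _; apply/bigmax_leqP => t _.
  by apply: leq_trans (size_scale_leq _ _) _; rewrite size_polyXn ltnS; have [] := eD t.
pose rs := [seq s ^+ val j | j <- enum 'I_dd].
have rs_root : all (root g) rs.
  apply/allP => _ /mapP[i _ ->]; rewrite /root /g hornerD hornerN hornerXn horner_sum hw.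
  by rewrite subr_eq0; apply/eqP/eq_bigr => t _; rewrite hornerZ hornerXn.
have rs_uniq : uniq_roots rs.
  rewrite uniq_rootsE map_inj_in_uniq ?enum_uniq // => i j _ _.
  have hB (t : 'I_dd) : (t <= B)%N by have := ltn_ord t; lia.
  by move/(s_inj (hB i) (hB j)); apply: val_inj.
have [v gv] : exists v : {poly K}, g = v * \prod_(j < dd) ('X - (s ^+ j)%:P).
  have [v gv] := uniq_roots_prod_XsubC rs_root rs_uniq.
  by exists v; rewrite gv /rs big_map big_enum.
have size_v : v != 0 -> (size v + dd <= D.+1)%N.
  move=> v0; have := sg; rewrite gv size_Mmonic ?monic_prod_XsubC // size_prod_XsubC.
  by rewrite -[index_enum _]enumT size_enum_ord addnS.
exists w, e, v; split=> // [|v0]; last first.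
  by have := size_v v0; rewrite -size_poly_gt0 in v0; lia.
have -> : l ^+ (D - b) * z ^+ b = bform D g + \sum_t w t *: (l ^+ (D - e t) * z ^+ e t).
  rewrite bformB bformXn // bform_sum.
  under [in X in _ - X]eq_bigr => t _ do rewrite bformZ bformXn ?(proj1 (eD t)) //.
  by rewrite subrK.
rewrite addrC; congr (_ + _); rewrite gv.
have bform0 E : bform E 0 = 0.
  by rewrite /bform big1 // => i _; rewrite coef0 scale0r.
have [->|v0] := eqVneq v 0; first by rewrite mul0r !bform0 mul0r.
have := size_v v0; have v1 : (0 < size v)%N by rewrite size_poly_gt0.
by move=> hs; rewrite -bform_prod ?subnK //; lia.
Qed.

End BinaryForms.

(** * The witness system *)

Section Witness.
Variables (K : fieldType) (n : nat) (d : 'I_n.+1 -> nat) (s : K).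
Hypothesis d_gt0 : forall j, (0 < d j)%N.
Local Notation N := (n.+1).
Local Notation R := {mpoly K[n.+1]}.
Local Notation B := (socdeg d).+1.
Hypothesis s_inj : forall a b, (a <= B)%N -> (b <= B)%N -> s ^+ a = s ^+ b -> a = b.
Implicit Types (m : 'X_{1..n.+1}) (p h q : R).

(* Variables shifted by one, so that the variable before the first one is [0]. *)
Definition xv (j : nat) : R := if j is j'.+1 then 'X_(inord j') else 0.

Definition wit (j : 'I_N) : R := \prod_(t < d j) (xv j.+1 - s ^+ t *: xv j).

Definition hdeg (r D : nat) : pred 'X_{1..n.+1} :=
  fun m => (mdeg m == D) && [forall j : 'I_N, (r <= j)%N ==> (m j == 0%N)].

Lemma hdegP r D m : reflect (mdeg m = D /\ forall j : 'I_N, (r <= j)%N -> m j = 0%N) (hdeg r D m).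
Proof.
apply: (iffP andP) => [[/eqP h1 /forallP h2]|[h1 h2]].
  by split=> // j rj; apply/eqP; apply: (implyP (h2 j)).
by rewrite h1 eqxx; split=> //; apply/forallP => j; apply/implyP => /h2 ->.
Qed.

Lemma hdeg_degle r D p : onmon (hdeg r D) p -> onmon (degle D) p.
Proof. by apply: onmonW => m /hdegP[h _]; rewrite /degle h. Qed.

Lemma hdeg_leq r r' D p : (r <= r')%N -> onmon (hdeg r D) p -> onmon (hdeg r' D) p.
Proof.
move=> rr; apply: onmonW => m /hdegP[h1 h2]; apply/hdegP; split=> // j rj.
by apply: h2; apply: leq_trans rj.
Qed.

Lemma hdegM r D E p q : onmon (hdeg r D) p -> onmon (hdeg r E) q -> onmon (hdeg r (D + E)) (p * q).
Proof.
move=> hp hq; apply: (onmonM hp hq) => m m' /hdegP[h1 h2] /hdegP[h3 h4].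
by apply/hdegP; rewrite mdegD h1 h3; split=> // j rj; rewrite mnmDE h2 ?h4.
Qed.

Lemma hdeg1 r : onmon (hdeg r 0) (1 : R).
Proof.
rewrite -mpolyX0; apply: onmonX; apply/hdegP; rewrite mdeg0.
by split=> // j _; rewrite mnm0E.
Qed.

Lemma hdegXn r D k p : onmon (hdeg r D) p -> onmon (hdeg r (k * D)) (p ^+ k).
Proof.
by move=> hp; elim: k => [|k IH]; [apply: hdeg1|rewrite exprS mulSn; apply: hdegM].
Qed.

Lemma hdeg_xv r j : (j <= r)%N -> (j <= N)%N -> onmon (hdeg r 1) (xv j).
Proof.
case: j => [|j] jr jN; first exact: onmon0.
apply: onmonX; apply/hdegP; rewrite mdeg1; split=> // k rk; rewrite mnm1E.
case: eqP => // e; move: (congr1 val e) => /=; rewrite inordK //; lia.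
Qed.

Lemma hdeg_xvn r j k : (j <= r)%N -> (j <= N)%N -> onmon (hdeg r k) (xv j ^+ k).
Proof. by move=> jr jN; rewrite -[X in hdeg r X]muln1; apply/hdegXn/hdeg_xv. Qed.

Lemma wit_hom (j : 'I_N) : onmon (hdeg j.+1 (d j)) (wit j).
Proof.
rewrite /wit; elim: (d j) => [|k IH]; first by rewrite big_ord0; apply: hdeg1.
rewrite big_ord_recr -[X in hdeg _ X]addn1; apply: hdegM IH _.
by apply: onmonB; [|apply: onmonZ]; apply: hdeg_xv; have := ltn_ord j; lia.
Qed.

(** The counterpart of [socdeg] for the first [r] forms. *)
Definition cs (r : nat) : nat := \sum_(j < N | (j < r)%N) (d j).-1.

Lemma cs0 : cs 0 = 0%N.
Proof. by rewrite /cs big1. Qed.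

Lemma csS (j : 'I_N) : cs j.+1 = (cs j + (d j).-1)%N.
Proof.
rewrite /cs (bigD1 j) ?ltnSn //= addnC; congr (_ + _)%N.
by apply: eq_bigl => k; rewrite ltnS ltn_neqAle andbC.
Qed.

Lemma cs_N : cs N = socdeg d.
Proof. by apply: eq_bigl => j; rewrite ltn_ord. Qed.

Lemma cs_le r : (cs r <= socdeg d)%N.
Proof. by rewrite /cs /socdeg big_mkcond leq_sum // => j _; case: ifP. Qed.

Local Notation J r D := (comb wit (IQ d r D)).

(** Membership in the image of [l^(2D-c)] from degree [c - D], with [l = xv r] and [c = cs r]. The
    clause [D <= cs r] forces [h = 0] above degree [c], where the truncated [c - D] would admit
    constants. *)
Definition lef (r D : nat) p : Prop :=
  exists h, J r D (p - xv r ^+ (2 * D - cs r) * h) /\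
    onmon (fun m => hdeg r (cs r - D) m && (D <= cs r)%N) h.

Lemma lef0 r D : lef r D 0.
Proof. by exists 0; rewrite mulr0 subrr; split; [apply: comb0|apply: onmon0]. Qed.

Lemma lefD r D p q : lef r D p -> lef r D q -> lef r D (p + q).
Proof.
move=> [h [h1 h2]] [h' [h1' h2']]; exists (h + h'); split; last exact: onmonD.
by rewrite mulrDr opprD addrACA; apply: combD.
Qed.

Lemma lefZ r D a p : lef r D p -> lef r D (a *: p).
Proof.
move=> [h [h1 h2]]; exists (a *: h); split; last exact: onmonZ.
by rewrite -scalerAr -scalerBr; apply: combZ.
Qed.

Lemma lef_J r D p : J r D p -> lef r D p.
Proof. by move=> hp; exists 0; rewrite mulr0 subr0; split=> //; apply: onmon0. Qed.

Lemma J_leq r r' D D' p : (r <= r')%N -> (D <= D')%N -> J r D p -> J r' D' p.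
Proof.
move=> rr DD; apply: combW => j m /andP[h1 h2]; rewrite /IQ.
by rewrite (leq_trans h1 rr) (leq_trans h2 DD).
Qed.

Definition surj (r : nat) : Prop := forall D p, (D <= B)%N -> (cs r <= 2 * D)%N ->
  onmon (hdeg r D) p -> lef r D p.

(* Degree-[a] part of the span, modulo the ideal, of the strings [l^i * p] of
   primitive elements [p], where [l] is the last of the first [r] variables. *)
Inductive prim_span (r a : nat) : R -> Prop :=
| PrimJ p of J r a p : prim_span r a p
| PrimD p q of prim_span r a p & prim_span r a q : prim_span r a (p + q)
| PrimX e p of (e <= a)%N & (2 * e <= cs r)%N & onmon (hdeg r e) p &
    J r (e + (cs r - 2 * e).+1) (xv r ^+ (cs r - 2 * e).+1 * p) :
    prim_span r a (xv r ^+ (a - e) * p).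

Lemma prim_span_mul r a k p : (r <= N)%N -> prim_span r a p ->
  prim_span r (a + k) (xv r ^+ k * p).
Proof.
move=> rN; elim=> {p} [p hJ|p q _ h1 _ h2|e p ea ec hp hJ].
- apply: PrimJ; rewrite addnC; apply: IQ_mul hJ.
  exact: hdeg_degle (@hdeg_xvn r r _ (leqnn r) rN).
- by rewrite mulrDr; apply: PrimD.
rewrite mulrA -exprD (_ : k + (a - e) = a + k - e)%N; last by lia.
by apply: PrimX => //; apply: leq_trans ea (leq_addr _ _).
Qed.

(** The Lefschetz decomposition, by induction on [a], modulo the ideal and with [c = cs r]. If
    [2a > c], then [p = l^(2a-c) * h] with [h] of smaller degree. Otherwise surjectivity in degree
    [c - a + 1] gives [l^(c-2a+1) * p = l^(c-2a+2) * h] with [h] of degree [a - 1], so [p - l * h]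
    is primitive. *)
Lemma surj_prim_span r a p : (r <= N)%N -> surj r -> (a <= B)%N ->
  onmon (hdeg r a) p -> prim_span r a p.
Proof.
move=> rN hS; have [k] := ubnP a; elim: k a p => // k IH a p ak aB hp.
have xp i : onmon (hdeg r i) (xv r ^+ i) by apply: hdeg_xvn.
have hcs := cs_le r.
case: (leqP (2 * a) (cs r)) => hc; last first.
  have [h [h1 h2]] := hS a p aB (ltnW hc) hp.
  rewrite -[p](subrK (xv r ^+ (2 * a - cs r) * h)); apply: PrimD; first exact: PrimJ.
  case: (leqP a (cs r)) => ac; last first.
    rewrite (_ : h = 0) ?mulr0; first by apply/PrimJ/comb0.
    apply/mpolyP => m; rewrite mcoeff0; apply/eqP; rewrite mcoeff_eq0; apply/negP.
    by move=> /h2 /andP[_]; rewrite leqNgt ac.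
  have h3 : onmon (hdeg r (cs r - a)) h by apply: onmonW h2 => m /andP[].
  have := prim_span_mul (2 * a - cs r) rN (IH (cs r - a)%N h _ _ h3).
  by rewrite (_ : cs r - a + (2 * a - cs r) = a)%N; [apply|]; lia.
have [|||h [h1 h2]] := hS (cs r - a).+1 (xv r ^+ (cs r - 2 * a).+1 * p); try lia.
  have -> : (cs r - a).+1 = ((cs r - 2 * a).+1 + a)%N by lia.
  exact: hdegM.
have e1 : (2 * (cs r - a).+1 - cs r = (cs r - 2 * a).+1.+1)%N by lia.
rewrite e1 [xv r ^+ _.+2]exprSr -mulrA -mulrBr in h1.
have e2 : (cs r - (cs r - a).+1 = a.-1)%N by lia.
rewrite e2 in h2.
have hxh : onmon (hdeg r a) (xv r * h).
  case: a h2 {ak aB hp hc h1 e1 e2} => [|a] h2.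
    rewrite (_ : h = 0) ?mulr0; first exact: onmon0.
    apply/mpolyP => m; rewrite mcoeff0; apply/eqP; rewrite mcoeff_eq0; apply/negP.
    by move=> /h2 /andP[_]; rewrite subn0 ltnn.
  by rewrite -[a.+1]add1n; apply: hdegM; [have := xp 1%N; rewrite expr1|apply: onmonW h2 => m /andP[]].
rewrite -[p](subrK (xv r * h)); apply: PrimD.
  rewrite -[p - _]mul1r -(expr0 (xv r)) -(subnn a); apply: PrimX => //.
    exact: onmonB.
  by have -> : (a + (cs r - 2 * a).+1 = (cs r - a).+1)%N by lia.
case: a h2 ak aB {hp hc h1 e1 e2 hxh} => [|a] h2 ak aB.
  rewrite (_ : h = 0) ?mulr0; first by apply/PrimJ/comb0.
  apply/mpolyP => m; rewrite mcoeff0; apply/eqP; rewrite mcoeff_eq0; apply/negP.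
  by move=> /h2 /andP[_]; rewrite subn0 ltnn.
have h3 : onmon (hdeg r a) h by apply: onmonW h2 => m /andP[].
have := prim_span_mul 1 rN (IH a h _ _ h3); rewrite addn1 expr1; apply; lia.
Qed.

(** With [l = xv j] and [z = xv j.+1], apply [binary_form] to the coefficient of a primitive [p] of
    degree [e], taking for [m] the exponent [cs j - 2e + 1] that kills [p] and for [k] the wanted
    power [2(a+b) - cs j.+1] of [z]. Multiples of [l^m * p] and of [wit j] lie in the ideal; the
    remaining terms are multiples of [z^k]. *)
Lemma prim_span_lef (j : 'I_N) a b p : (a + b <= B)%N -> (cs j.+1 <= 2 * (a + b))%N ->
  prim_span j a p -> lef j.+1 (a + b) (p * xv j.+1 ^+ b).
Proof.
move=> abB hcs; have jN : (j <= N)%N by have := ltn_ord j; lia.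
have hz i : onmon (hdeg j.+1 i) (xv j.+1 ^+ i) by apply: hdeg_xvn; have := ltn_ord j; lia.
have hl i : onmon (hdeg j.+1 i) (xv j ^+ i) by apply: hdeg_xvn; have := ltn_ord j; lia.
have hc := csS j; have dj := d_gt0 j.
elim=> {p} [p hJ|p q _ h1 _ h2|e p ea ec hp hJ].
- apply/lef_J; rewrite mulrC; apply: J_leq (leqnSn j) (leqnn _) _.
  by rewrite [(a + b)%N]addnC; apply: IQ_mul hJ; apply: hdeg_degle (hz _).
- by rewrite mulrDl; apply: lefD.
have hD : (2 * (a + b - e) + 2 = (cs j - 2 * e).+1 + d j + (2 * (a + b) - cs j.+1))%N by lia.
have h1 : (a + b - e <= B)%N by lia.
have h2 : (b <= a + b - e)%N by lia.
have [w [t [v [E ht hv]]]] := binary_form (xv j) (xv j.+1) s_inj hD (ltn0Sn _) dj h1 h2.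
have -> : xv j ^+ (a - e) * p * xv j.+1 ^+ b =
          xv j ^+ (a + b - e - b) * xv j.+1 ^+ b * p.
  by rewrite (_ : a + b - e - b = a - e)%N; [ring|lia].
rewrite E mulrDl mulr_suml; apply: lefD.
  elim/big_ind: _ => [||i _]; [exact: lef0|exact: lefD|].
  rewrite -scalerAl; apply: lefZ; have [tD [tm|tk]] := ht i.
    apply: lef_J.
    have -> : xv j ^+ (a + b - e - t i) * xv j.+1 ^+ t i * p =
      (xv j ^+ (a + b - e - t i - (cs j - 2 * e).+1) * xv j.+1 ^+ t i) *
      (xv j ^+ (cs j - 2 * e).+1 * p).
      by rewrite -[in LHS](subnK tm) exprD; ring.
    have := IQ_mul (hdeg_degle (hdegM (hl _) (hz (t i)))) hJ.
    by move=> /(_ (a + b - e - t i - (cs j - 2 * e).+1)%N); apply: J_leq => //; lia.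
  exists (xv j ^+ (a + b - e - t i) * xv j.+1 ^+ (t i - (2 * (a + b) - cs j.+1)) * p).
  split.
    rewrite (_ : _ - _ = 0); first exact: comb0.
    by rewrite -{2}(subnKC tk) exprD; ring.
  have hpp : onmon (hdeg j.+1 e) p by apply: hdeg_leq hp.
  have := hdegM (hdegM (hl (a + b - e - t i)%N) (hz (t i - (2 * (a + b) - cs j.+1))%N)) hpp.
  apply: onmonW => m hm; apply/andP; split; last by lia.
  by move: hm; congr (is_true (hdeg _ _ _)); lia.
apply: lef_J; have [->|v0] := eqVneq v 0.
  rewrite /bform [X in X * _ * _]big1 ?mul0r; first exact: comb0.
  by move=> i _; rewrite coef0 scale0r.
rewrite mulrAC; apply: comb_gen.
have : onmon (hdeg j.+1 (a + b - e - d j + e)) (bform (xv j) (xv j.+1) (a + b - e - d j) v * p).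
  apply: hdegM; last by apply: hdeg_leq hp.
  apply: onmon_sum => i _; apply: onmonZ.
  have := hdegM (hl (a + b - e - d j - i)%N) (hz i).
  by rewrite subnK //; have := ltn_ord i; lia.
apply: onmonW => m /hdegP[mD _]; rewrite /IQ ltnSn mD.
by have := hv v0; lia.
Qed.

(** A monomial is a power of [X_j] times a monomial in the first [j] variables, to which the
    primitive decomposition applies. *)
Lemma surjS (j : 'I_N) : surj j -> surj j.+1.
Proof.
move=> hS D p DB hc; move: p; apply: onmon_ind => [|p q|a p|m /hdegP[mD m0]];
  [exact: lef0|exact: lefD|exact: lefZ|].
have jN : (j <= N)%N by have := ltn_ord j; lia.
have em := mnm_splitU (leqnn (m j)); have dm := mdeg_splitU (leqnn (m j)).
rewrite -em mpolyXD.
have -> : 'X_[U_(j) *+ m j] = xv j.+1 ^+ m j :> R by rewrite /= inord_val mpolyXn.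
have eD : (D - m j + m j = D)%N by lia.
rewrite -eD; apply: prim_span_lef; rewrite ?eD //.
apply: surj_prim_span => //; first by lia.
apply: onmonX; apply/hdegP; split; first by lia.
move=> k jk; rewrite mnmBE mulmnE mnm1E; have [->|kj] := eqVneq j k.
  by rewrite mul1n subnn.
rewrite mul0n subn0; apply: m0; rewrite ltn_neqAle jk andbT.
by apply: contra_neq kj => /val_inj.
Qed.

Lemma wit_surj r : (r <= N)%N -> surj r.
Proof.
elim: r => [_|r IH rN]; last exact: (@surjS (Ordinal rN)) (IH (ltnW rN)).
move=> [|D] p _ _ hp.
  exists p; rewrite cs0 expr0 mul1r subrr; split; first exact: comb0.
  by apply: onmonW hp => m ->.
rewrite (_ : p = 0); first exact: lef0.
apply/mpolyP => m; rewrite mcoeff0; apply/eqP; rewrite mcoeff_eq0; apply/negP.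
by move=> /hp/hdegP[mD m0]; move: mD; rewrite mdegE big1 // => j _; apply: m0.
Qed.

End Witness.

(** * Spanning rows of both families of matrices at the witness *)

Section WitnessSpans.
Variables (K : fieldType) (n : nat) (d : 'I_n.+1 -> nat) (s : K).
Hypothesis d_gt0 : forall j, (0 < d j)%N.
Local Notation N := (n.+1).
Local Notation R := {mpoly K[n.+1]}.
Local Notation wit := (wit d s).
Implicit Types (m : 'X_{1..n.+1}) (p : R).

Lemma wit_deg j : onmon (degle (d j)) (wit j).
Proof. exact: hdeg_degle (@wit_hom K n d s j). Qed.

(** [mnmwgt] gives the variable of index [i] weight [i + 1]. In [wit j], every monomial but the
    power of [X_j] replaces some [X_j] by the preceding variable, which lowers the weight. *)
Definition dwt (D w : nat) : pred 'X_{1..n.+1} := fun m => (mdeg m == D) && (mnmwgt m < w)%N.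

Lemma wit_tail (j : 'I_N) :
  onmon (dwt (d j) (d j * j.+1)) (wit j - 'X_[U_(j) *+ d j]).
Proof.
have hX : onmon (dwt 1 j.+2) ('X_j : R).
  by apply: onmonX; rewrite /dwt mdeg1 mnmwgt1 ltnSn.
have hl : onmon (dwt 1 j.+1) (xv K n j).
  case: (j : nat) (ltn_ord j) => [|k] hk; first exact: onmon0.
  by apply: onmonX; rewrite /dwt mdeg1 mnmwgt1 inordK ?ltnSn //; lia.
have dwtM D E w v p q : onmon (dwt D w) p -> onmon (dwt E v.+1) q ->
    onmon (dwt (D + E) (w + v)) (p * q).
  move=> hp hq; apply: (onmonM hp hq) => m m' /andP[/eqP h1 h2] /andP[/eqP h3 h4].
  by rewrite /dwt mdegD h1 h3 eqxx mnmwgtD; lia.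
have hXn k : onmon (dwt k (k * j.+1).+1) ('X_j ^+ k : R).
  elim: k => [|k IH].
    by rewrite expr0 -mpolyX0; apply: onmonX; rewrite /dwt mdeg0 mnmwgt0.
  rewrite exprSr; have := dwtM _ _ _ _ _ _ IH hX; rewrite addn1.
  by congr (onmon (dwt _ _)); lia.
rewrite -mpolyXn /wit; elim: (d j) => [|k IH].
  by rewrite big_ord0 expr0 subrr; apply: onmon0.
rewrite big_ord_recr /= inord_val.
have -> : \prod_(i < k) ('X_j - s ^+ i *: xv K n j) * ('X_j - s ^+ k *: xv K n j) - 'X_j ^+ k.+1 =
  (\prod_(i < k) ('X_j - s ^+ i *: xv K n j) - 'X_j ^+ k) * ('X_j - s ^+ k *: xv K n j) -
  s ^+ k *: xv K n j * 'X_j ^+ k by rewrite exprSr; ring.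
rewrite /= inord_val in IH; apply: onmonB.
  have h : onmon (dwt 1 j.+2) ('X_j - s ^+ k *: xv K n j).
    apply: onmonB; [exact: hX|apply: onmonZ]; apply: onmonW hl => m /andP[h1 h2].
    by rewrite /dwt h1; apply: leq_trans h2 _.
  have := dwtM _ _ _ _ _ _ IH h; rewrite addn1.
  by congr (onmon (dwt _ _)); lia.
have := dwtM _ _ _ _ _ _ (@onmonZ _ _ _ (s ^+ k) _ hl) (hXn k).
by rewrite add1n mulSn.
Qed.

(** Each row is its own monomial plus terms of the same degree and smaller weight, so Macaulay's
    matrix is unitriangular, whatever [s] is. *)
Lemma wit_theta i D p : onmon (degle D) p ->
  lspan (fun m : 'X_{1..N < D.+1} => theta d wit i m) p.
Proof.
have hgen m : (mdeg m <= D)%N ->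
    lspan (fun m : 'X_{1..N < D.+1} => theta d wit i m) (theta d wit i m).
  by move=> hm; exact: (lspan_gen _ (BMultinom (hm : (mdeg m < D.+1)%N))).
apply: onmon_ind => [|q q'|a q|m hm];
  [exact: lspan0|exact: lspanD|exact: lspanZ|].
have [w] := ubnP (mnmwgt m); elim: w m hm => // w IH m hm mw.
have := hgen _ hm; rewrite /theta; case: (pivotP d i m) => // j ji hd hb h.
have em := mnm_splitU hd; have dm := mdeg_splitU hd.
rewrite -em mpolyXD -[X in _ * X](subKr (wit j)) mulrBr.
apply: lspanD; first exact: h.
rewrite -scaleN1r; apply: lspanZ.
have : onmon (fun v => (mdeg v == mdeg m) && (mnmwgt v < mnmwgt m)%N)
    ('X_[m - U_(j) *+ d j] * (wit j - 'X_[U_(j) *+ d j])).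
  apply: (onmonM (@onmonX K _ (pred1 _) _ (eqxx _)) (@wit_tail j)).
  move=> _ v /eqP-> /andP[/eqP v1 v2]; rewrite mdegD v1 dm eqxx /=.
  rewrite -[in X in (_ < X)%N]em !mnmwgtD ltn_add2l.
  suff -> : mnmwgt (U_(j) *+ d j)%MM = (d j * j.+1)%N by [].
  move: (d j) => k; elim: k => [|k IHk]; first by rewrite mulm0n mnmwgt0.
  by rewrite mulmS mnmwgtD mnmwgt1 IHk mulSn.
apply: onmon_ind => [|q q'|a q|v /andP[/eqP v1 v2]];
  [exact: lspan0|exact: lspanD|exact: lspanZ|].
by apply: IH; [rewrite /degle v1|lia].
Qed.

Lemma wit_all_reducible i D : all_reducible d wit i D.
Proof. by apply: theta_all_reducible => p; apply: wit_theta. Qed.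

Hypothesis s_inj : forall a b, (a <= (socdeg d).+1)%N -> (b <= (socdeg d).+1)%N ->
  s ^+ a = s ^+ b -> a = b.

(** By [wit_surj], a monomial of degree [D] is [z^(2D-c) * h] modulo products of degree at most [D],
    and [h] can be replaced by a box polynomial. Its monomials of degree [c - D] give the rows of
    their complements; lower degrees and the products reduce to rows [theta]. *)
Lemma wit_psi D p : (D <= socdeg d)%N -> (socdeg d <= 2 * D)%N -> onmon (degle D) p ->
  lspan (fun m : 'X_{1..N < D.+1} => psi d wit D m) p.
Proof.
move=> Dc cD; set L := lspan _.
have L0 : L 0 by exact: lspan0.
have LD q q' : L q -> L q' -> L (q + q') by exact: lspanD.
have LZ a q : L q -> L (a *: q) by exact: lspanZ.
have hgen m : (mdeg m <= D)%N -> L (psi d wit D m).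
  by move=> hm; exact: (lspan_gen _ (BMultinom (hm : (mdeg m < D.+1)%N))).
have hJ q : comb wit (IQ d N D) q -> L q.
  move=> /(IQ_VQ wit_deg (fun i D _ => @wit_all_reducible i D) (leqnn N)).
  apply: comb_ind => [|q1 q2|a q1|j m /andP[/andP[jN hm] hb]];
    [exact: L0|exact: LD|exact: LZ|].
  rewrite -(@theta_gen _ _ d wit N) //.
  have := hgen (m + U_(j) *+ d j)%MM; rewrite mdegD mdegMn mdeg1 mul1n => /(_ hm).
  rewrite /psi ifN // negb_and; apply/orP; left; apply/negP => /belowP /(_ j (ltn_ord j)).
  by rewrite mnmDE mulmnE mnm1E eqxx; lia.
have hlow m : (mdeg m < D)%N -> L 'X_[m].
  move=> mD; have hm : onmon (degle D.-1) ('X_[m] : R) by apply: onmonX; rewrite /degle; lia.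
  have [b [h1 h2]] := @wit_all_reducible N D.-1 _ hm; rewrite -['X_[m]](subrK b); apply: (LD).
    by apply: (hJ); apply: IQ_leq h1; lia.
  move: b h2 {h1}; apply: onmon_ind => [|q1 q2|a q1|v /andP[vb vD]];
    [exact: L0|exact: LD|exact: LZ|].
  have := hgen v; rewrite /psi vb theta_box // ifN; first by apply; lia.
  by apply/eqP; lia.
apply: onmon_ind => [|q1 q2|a q1|m hm];
  [exact: L0|exact: LD|exact: LZ|].
move: (hm); rewrite /degle leq_eqVlt => /orP[/eqP mD|]; last exact: hlow.
have hh : onmon (hdeg N D) ('X_[m] : R).
  by apply/onmonX/hdegP; split=> // j; rewrite leqNgt ltn_ord.
have [||h [h1 h2]] := wit_surj d_gt0 s_inj (leqnn N) _ _ hh; rewrite ?cs_N //.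
  by apply: leq_trans Dc _.
have zE k : xv K n N ^+ k = zpow K n k.
  by rewrite zpowE /=; congr ('X_ _ ^+ _); apply: val_inj; rewrite /= inordK.
rewrite !cs_N zE in h1 h2; set k := (2 * D - socdeg d)%N in h1.
rewrite -['X_[m]](subrK (zpow K n k * h)); apply: (LD); first exact: hJ.
have h3 : onmon (degle (socdeg d - D)) h.
  by apply: onmonW h2 => v /andP[/hdegP[vD _] _]; rewrite /degle vD.
have [b [h4 h5]] := @wit_all_reducible N (socdeg d - D) _ h3.
rewrite -[h](subrK b) mulrDr; apply: (LD).
  apply: (hJ); have := IQ_mul (_ : onmon (degle k) (zpow K n k)) h4.
  have -> : (k + (socdeg d - D) = D)%N by rewrite /k; lia.
  by apply; apply: onmonX; rewrite /degle mdegMn mdeg1 mul1n.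
move: b h5 {h4}; apply: (onmon_ind (C := fun b => L (zpow K n k * b))).
- by rewrite mulr0.
- by move=> q1 q2 hq1 hq2; rewrite mulrDr; apply: (LD).
- by move=> a q h'; rewrite -scalerAr; apply: (LZ).
move=> v /andP[vb vD].
move: vD; rewrite leq_eqVlt => /orP[/eqP vD|vD]; last first.
  by rewrite /zpow -mpolyXD; apply: (hlow); rewrite mdeg_zpow /k; lia.
have hv := mdeg_compl vb.
have := hgen (compl d v); rewrite /psi below_compl //= complK //.
have -> : mdeg (compl d v) = D by lia.
by rewrite eqxx; apply.
Qed.

End WitnessSpans.

(** * Genericity *)

Section PolynomialFunctions.
Variables (K : fieldType) (n : nat) (d : 'I_n -> nat).
Local Notation I := (CoeffIdx d).
Implicit Types (phi psi : (I -> K) -> K).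

Definition polyfun phi : Prop :=
  exists Q : {mpoly K[#|CoeffIdx d|]}, forall c, Q.@[coeff_pt c] = phi c.

Lemma polyfun_cst a : polyfun (fun _ => a).
Proof. by exists a%:MP => c; rewrite mevalC. Qed.

Lemma polyfun_coord (i : I) : polyfun (fun c => c i).
Proof. by exists 'X_(enum_rank i) => c; rewrite mevalXU /coeff_pt enum_rankK. Qed.

Lemma polyfunM phi psi : polyfun phi -> polyfun psi -> polyfun (fun c => phi c * psi c).
Proof. by move=> [P hP] [Q hQ]; exists (P * Q) => c; rewrite mevalM hP hQ. Qed.

Lemma polyfun_sum (J : Type) (r : seq J) (P : pred J) (phi : J -> (I -> K) -> K) :
  (forall j, polyfun (phi j)) -> polyfun (fun c => \sum_(j <- r | P j) phi j c).
Proof.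
move=> h; elim: r => [|j r [Q hQ]].
  by exists 0 => c; rewrite meval0 big_nil.
have [Q' hQ'] := h j; exists (if P j then Q' + Q else Q) => c.
by rewrite big_cons; case: (P j); rewrite ?mevalD ?hQ' hQ.
Qed.

Lemma polyfun_prod (J : Type) (r : seq J) (P : pred J) (phi : J -> (I -> K) -> K) :
  (forall j, polyfun (phi j)) -> polyfun (fun c => \prod_(j <- r | P j) phi j c).
Proof.
move=> h; elim: r => [|j r [Q hQ]].
  by exists 1 => c; rewrite meval1 big_nil.
have [Q' hQ'] := h j; exists (if P j then Q' * Q else Q) => c.
by rewrite big_cons; case: (P j); rewrite ?mevalM ?hQ' hQ.
Qed.

Lemma polyfun_det k (A : (I -> K) -> 'M[K]_k) :
  (forall i j, polyfun (fun c => A c i j)) -> polyfun (fun c => \det (A c)).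
Proof.
move=> h; apply: polyfun_sum => s; apply: polyfunM; first exact: polyfun_cst.
by apply: polyfun_prod => i; apply: h.
Qed.

Lemma polyfun_coeff p j m : polyfun (fun c => (p * dense_system c j)@_m).
Proof.
have h c : (p * dense_system c j)@_m =
    \sum_(v : 'X_{1..n < (d j).+1})
      c (Tagged (fun j => 'X_{1..n < (d j).+1}) v) * (p * 'X_[bmnm v])@_m.
  rewrite /dense_system mulr_sumr raddf_sum; apply: eq_bigr => v _.
  by rewrite -scalerAr /= mcoeffZ.
have [Q hQ] : polyfun (fun c => \sum_(v : 'X_{1..n < (d j).+1})
      c (Tagged (fun j => 'X_{1..n < (d j).+1}) v) * (p * 'X_[bmnm v])@_m).
  by apply: polyfun_sum => v; apply: polyfunM; [apply: polyfun_coord|apply: polyfun_cst].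
by exists Q => c; rewrite hQ h.
Qed.

Lemma polyfun_theta i v m : polyfun (fun c => (theta d (dense_system c) i v)@_m).
Proof.
by rewrite /theta; case: (pivot d i v) => [j|]; [apply: polyfun_coeff|apply: polyfun_cst].
Qed.

Lemma dense_system_deg (c : I -> K) j : onmon (degle (d j)) (dense_system c j).
Proof.
by apply: onmon_sum => v _; apply/onmonZ/onmonX; have := bmdeg v.
Qed.

Lemma dense_systemE (f : 'I_n -> {mpoly K[n]}) :
  (forall j, onmon (degle (d j)) (f j)) ->
  dense_system (fun x : I => (f (tag x))@_(bmnm (tagged x))) =1 f.
Proof. by move=> hf j; apply: esym (lspan_degle (hf j)). Qed.

Lemma theta_ext (f g : 'I_n -> {mpoly K[n]}) i v : f =1 g -> theta d f i v = theta d g i v.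
Proof. by move=> h; rewrite /theta; case: pivot => // j; rewrite h. Qed.

End PolynomialFunctions.

Lemma polyfun_psi (K : fieldType) n (d : 'I_n.+1 -> nat) D v m :
  polyfun (fun c : CoeffIdx d -> K => (psi d (dense_system c) D v)@_m).
Proof.
rewrite /psi; case: (below d n.+1 v && (mdeg v == D)); first exact: polyfun_cst.
exact: polyfun_theta.
Qed.

(** Take [s] outside the roots of [p]: if [s^a = s^b] with [a < b] and [s] nonzero, then
    [s^(b-a) = 1]. *)
Lemma distinct_powers (K : fieldType) (B : nat) :
  (forall r : seq K, exists x, x \notin r) ->
  exists s : K, forall a b, (a <= B)%N -> (b <= B)%N -> s ^+ a = s ^+ b -> a = b.
Proof.
move=> hK; pose p : {poly K} := 'X * \prod_(i < B) ('X^(i.+1) - 1).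
have p0 : p != 0.
  rewrite mulf_neq0 ?polyX_eq0 //; apply/prodf_neq0 => i _.
  by rewrite -size_poly_eq0 size_XnsubC.
have [rs [us srs]] : exists rs : seq K, uniq rs /\ size rs = size p.
  elim: (size p) => [|k [rs [us <-]]]; first by exists [::].
  by have [x hx] := hK rs; exists (x :: rs); rewrite /= hx us.
have /allPn[s _ hs] : ~~ all (root p) rs.
  by apply/negP => h; have := max_poly_roots p0 h us; rewrite srs ltnn.
exists s.
have hab a b : (a < b)%N -> (b <= B)%N -> s ^+ a != s ^+ b.
  move=> ab bB; apply: contraNneq hs => e; rewrite rootM rootX.
  have [//|s0] := eqVneq s 0.
  have iB : ((b - a).-1 < B)%N by lia.
  rewrite (bigD1 (Ordinal iB)) //= rootM prednK ?subn_gt0 //.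
  rewrite /root hornerD hornerN hornerXn hornerC subr_eq0; apply/orP; left.
  apply/eqP/(mulfI (expf_neq0 a s0)); rewrite mulr1 -exprD subnKC //; exact: ltnW.
move=> a b aB bB e; case: (ltngtP a b) => // h.
  by have := hab _ _ h bB; rewrite e eqxx.
by have := hab _ _ h aB; rewrite e eqxx.
Qed.

Section Generic.
Variables (K : fieldType) (n : nat) (d : 'I_n.+1 -> nat).
Local Notation c0 := (socdeg d).
Hypothesis d_gt0 : forall j, (0 < d j)%N.

Definition thetamx (f : 'I_n.+1 -> {mpoly K[n.+1]}) (i D : nat) :=
  rowmx (fun m : 'X_{1..n.+1 < D.+1} => theta d f i m).

Definition psimx (f : 'I_n.+1 -> {mpoly K[n.+1]}) (D : nat) :=
  rowmx (fun m : 'X_{1..n.+1 < D.+1} => psi d f D m).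

(** The first product covers every number of forms and the degrees up to [c0 + 1] required by
    [all_reducible_from_bound]; the second stops at [c0], the top degree of the box. *)
Definition resultant (c : CoeffIdx d -> K) : K :=
  (\prod_(i < n.+2) \prod_(D < c0.+2) \det (thetamx (dense_system c) i D)) *
  \prod_(D < c0.+1 | (c0 <= 2 * D)%N) \det (psimx (dense_system c) D).

Lemma polyfun_resultant : polyfun resultant.
Proof.
apply: polyfunM.
  apply: polyfun_prod => i; apply: polyfun_prod => D; apply: polyfun_det => a b.
  have [Q hQ] := @polyfun_theta K _ d i (enum_val a) (enum_val b).
  by exists Q => c; rewrite hQ mxE.
apply: polyfun_prod => D; apply: polyfun_det => a b.
have [Q hQ] := @polyfun_psi K _ d D (enum_val a) (enum_val b).
by exists Q => c; rewrite hQ mxE.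
Qed.

Lemma resultant_max_rank (c : CoeffIdx d -> K) : resultant c != 0 ->
  forall a k,
  (forall h r, onmon (@degeq n a) h -> onmon (@deglt n (a + k)) r ->
     in_ideal (dense_system c) (zpow K n k * h + r) ->
     exists2 r', onmon (@deglt n a) r' & in_ideal (dense_system c) (h + r')) \/
  (forall p, onmon (degle (a + k)) p ->
     exists h r, [/\ onmon (degle a) h, onmon (@deglt n (a + k)) r &
                     in_ideal (dense_system c) (p - (zpow K n k * h + r))]).
Proof.
rewrite mulf_eq0 negb_or => /andP[/prodf_neq0 h1 /prodf_neq0 h2].
have hdeg : forall j, onmon (degle (d j)) (dense_system c j) by apply: dense_system_deg.
apply: (@max_rank K n d (dense_system c)) => //.
  move=> i D hi; move: D; apply: all_reducible_from_bound => // D hD; apply: theta_all_reducible => p.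
  apply: rowmx_spans => [m|]; first by apply: theta_deg => //; have := bmdeg m.
  have /prodf_neq0 := h1 (Ordinal (hi : (i < n.+2)%N)) isT.
  by move/(_ (Ordinal (hD : (D < c0.+2)%N)) isT).
move=> D p hD h2D; apply: rowmx_spans => [m|].
  by apply: psi_deg => //; have := bmdeg m.
exact: (h2 (Ordinal (hD : (D < c0.+1)%N)) h2D).
Qed.

Lemma resultant_neq0 : (forall r : seq K, exists x, x \notin r) ->
  exists c, resultant c != 0.
Proof.
move=> /(distinct_powers c0.+1)[s s_inj].
have wdeg : forall j, onmon (degle (d j)) (wit d s j) by apply: wit_deg.
exists (fun x => (wit d s (tag x))@_(bmnm (tagged x))).
have E := dense_systemE wdeg.
rewrite mulf_neq0 //.
  apply/prodf_neq0 => i _; apply/prodf_neq0 => D _; apply: spans_det => m.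
  have [|a ha] := @wit_theta K n d s i D 'X_[m].
    by apply/onmonX; have := bmdeg m.
  by exists a; rewrite {1}ha; apply: eq_bigr => v _; rewrite (theta_ext _ _ _ E).
apply/prodf_neq0 => D hD; apply: spans_det => m.
have [||a ha] := @wit_psi K n d s d_gt0 s_inj D 'X_[m] _ hD.
- by rewrite -ltnS ltn_ord.
- by apply/onmonX; have := bmdeg m.
exists a; rewrite {1}ha; apply: eq_bigr => v _; congr (_ *: _).
by rewrite /psi; case: ifP => // _; rewrite (theta_ext _ _ _ E).
Qed.

End Generic.

(* n.+1 variables x_1 > ... > x_(n+1); the last one, x_(n+1) = 'X_ord_max,
   plays the role of the paper's x_n.  For a generic dense system with degrees
   d, every column of T_(last) (the normal form of eps * x_last, eps in B) is
   either a unit vector (eps * x_last in B) or the negated tail of an element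
   g of the reduced DRL Groebner basis with LT(g) = eps * x_last; hence T is
   read off G_drl with no arithmetic operation (only sign changes). *)
Theorem theorem7p1 (K : fieldType) (n : nat) (d : 'I_n.+1 -> nat) :
  @generic_in K n.+1 d (fun c =>
    forall G : seq {mpoly K[n.+1]},
      is_reduced_drl_gb (in_ideal (dense_system c)) G ->
      forall e : 'X_{1..n.+1}, std_mon G e ->
        let ex := (e + U_(ord_max))%MM in
        exists r : {mpoly K[n.+1]},
          is_nf (in_ideal (dense_system c)) G 'X_[ex] r /\
          ((std_mon G ex /\ r = 'X_[ex]) \/
           (exists g, [/\ g \in G, is_lm g ex & r = 'X_[ex] - g]))).
Proof.
(* If some [d j = 0], that form is a constant; where it is nonzero the ideal is the unit ideal and
   there is no standard monomial. *)
have [/existsP[j /eqP dj]|/existsPn d_gt0] := boolP [exists j, d j == 0%N].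
  have m0 : (mdeg (0%MM : 'X_{1..n.+1}) < (d j).+1)%N by rewrite mdeg0.
  pose i0 : CoeffIdx d := Tagged (fun j => 'X_{1..n.+1 < (d j).+1}) (BMultinom m0).
  exists [:: 'X_(enum_rank i0)]; split.
    by exists (fun _ => 1); rewrite /= mevalXU oner_eq0.
  move=> c; rewrite /= mevalXU /coeff_pt enum_rankK orbF => ci G hG e he.
  have E : dense_system c j = c i0 *: 'X_[0].
    rewrite /dense_system (bigD1 (BMultinom m0)) //= big1 ?addr0 // => v vm.
    have v0 : mdeg v = 0%N by have := bmdeg v; rewrite [in X in (_ < X)%N]dj; case: mdeg.
    by case/eqP: vm; apply: val_inj; apply/eqP; rewrite /= -mdeg_eq0 v0.
  have I1 : in_ideal (dense_system c) 'X_[0].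
    rewrite -['X_[0]](scalerK ci) -E -mul_mpolyC; apply: idealM.
    by apply/ideal_comb; rewrite -[dense_system c j]mul1r; apply: comb_gen.
  have l0 : is_lm ('X_[0] : {mpoly K[n.+1]}) 0%MM.
    by rewrite /is_lm msuppX inE eqxx /= eqxx.
  case: (ideal_lm_nstd hG I1 l0); apply: std_mon_dvd he.
  by apply/mnm_lepP => i; rewrite mnm0E.
have {}d_gt0 j : (0 < d j)%N by rewrite lt0n.
have [hK|hK] := classic (forall r : seq K, exists x, x \notin r).
  have [Q hQ] := polyfun_resultant K d; have [c hc] := resultant_neq0 d_gt0 hK.
  exists [:: Q]; split; first by exists c; rewrite /= hQ hc.
  move=> c'; rewrite /= hQ orbF => hc' G hG e he.
  apply: (column_nf hG _ he); exact: (@resultant_max_rank K n d d_gt0 c' hc').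
have [r hr] : exists r : seq K, forall x, x \in r.
  apply: NNPP => h; apply: hK => r; apply: NNPP => h'; apply: h; exists r => x.
  by apply: NNPP => /negP hx; apply: h'; exists x.
(* Over a finite field the single point [c = 0] is Zariski-open. *)
exists [:: \prod_i \prod_(a <- r | a != 0) ('X_i - a%:MP)]; split.
  exists (fun _ => 0); rewrite /= orbF rmorph_prod; apply/prodf_neq0 => i _.
  rewrite rmorph_prod /= big_seq_cond; elim/big_ind: _ => [|x y|a /andP[_ a0]].
  - exact: oner_neq0.
  - exact: mulf_neq0.
  by rewrite mevalB mevalXU mevalC sub0r oppr_eq0.
move=> c; rewrite /= orbF rmorph_prod => /prodf_neq0 hc.
have c0 i : c i = 0.
  apply/eqP/negPn/negP => ci; have := hc (enum_rank i) isT.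
  rewrite rmorph_prod /= (big_rem (c i)) //= ci mevalB mevalXU mevalC.
  by rewrite /coeff_pt enum_rankK subrr mul0r eqxx.
have f0 j : dense_system c j = 0.
  by rewrite /dense_system big1 // => v _; rewrite c0 scale0r.
move=> G [_ hGI hGm _ _] e he; set ex := (e + _)%MM.
(* The ideal is zero, so an element of [G] would be zero and yet have a leading monomial: every
   monomial is standard. *)
have hs : std_mon G ex.
  move=> g t gG _; have [t' [lt' _]] := hGm _ gG.
  have [q gq] := hGI _ gG; move: lt'; rewrite gq big1 => [|j _]; last by rewrite f0 mulr0.
  by rewrite /is_lm msupp0.
exists 'X_[ex]; split; last by left.
split; first by rewrite subrr; apply: ideal0.
by move=> m; rewrite msuppX inE => /eqP->.
Qed.
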